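(* Let $K$ be a perfect field, let $n\ge1$, let $\mathbb{X}$ be a 0-dimensional scheme in $\mathbb{P}^n_K$ such that no point of its support lies on the hyperplane $X_0=0$, let $R$ be its homogeneous coordinate ring, and let $\mathbb{Y}$ be the differential fattening of $\mathbb{X}$. (a) For $i\in\mathbb{N}$ we have $$\operatorname{HF}_{\Omega^1_R}(i)=(n+1)\operatorname{HF}_{\mathbb{X}}(i-1)+\operatorname{HF}_{\mathbb{X}}(i)-\operatorname{HF}_{\mathbb{Y}}(i).$$ In particular, $\operatorname{HP}(\Omega^1_R)=(n+2)\deg(\mathbb{X})-\deg(\mathbb{Y})$, and the regularity index of $\Omega^1_R$ satisfies $\operatorname{ri}(\Omega^1_R)\le\max\{r_{\mathbb{X}}+1,r_{\mathbb{Y}}\}$. (b) Suppose that $\mathbb{X}=m_1p_1+\cdots+m_sp_s$ is a fat point scheme in $\mathbb{P}^n_K$ and let $p=\operatorname{char}(K)$. (i) We have $$ \operatorname{HP}(\Omega^1_R)=\sum_{j=1}^s\Big[(n+2)\binom{m_j+n-1}{n}-\binom{m_j+n}{n}\Big]+\sum_{j:\ p\mid m_j}\#\Big\{(\alpha_1,\dots,\alpha_n)\in\mathbb{N}^n\ \Big|\ \sum_{i=1}^n\alpha_i=\frac{m_j}{p}\Big\}. $$ (ii) We have $m_1=\cdots=m_s=1$ if and only if $\operatorname{HP}(\Omega^1_R)=s$.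
   Context: $P=K[X_0,\dots,X_n]$ is standard graded, $I_{\mathbb{X}}$ is the saturated homogeneous ideal of $P$ defining the 0-dimensional (closed sub)scheme $\mathbb{X}$, and $R=P/I_{\mathbb{X}}$. $\mathbb{N}=\{0,1,2,\dots\}$. $\Omega^1_R=\Omega^1_{R/K}$ is the graded module of Kähler differentials of $R/K$ (with $\deg(dx_i)=1$, $x_i$ the image of $X_i$). For a finitely generated graded module $M$, $\operatorname{HF}_M(i)=\dim_K(M_i)$, $\operatorname{HP}(M)$ is its Hilbert polynomial, and $\operatorname{ri}(M)=\min\{i\in\mathbb{Z}\mid\operatorname{HF}_M(j)=\operatorname{HP}_M(j)\text{ for all } j\ge i\}$. For a 0-dimensional scheme $\mathbb{W}$ with homogeneous coordinate ring $P/I_{\mathbb{W}}$: $\operatorname{HF}_{\mathbb{W}}=\operatorname{HF}_{P/I_{\mathbb{W}}}$, $r_{\mathbb{W}}=\operatorname{ri}(P/I_{\mathbb{W}})$, and $\deg(\mathbb{W})$ is the constant Hilbert polynomial of $P/I_{\mathbb{W}}$. Constant Hilbert polynomials are identified with integers. $K$-linear differential operators on $P$: $D_P^0=\operatorname{Hom}_P(P,P)$, and for $m\ge1$, $D_P^m=\{\delta\in\operatorname{Hom}_K(P,P)\mid \delta\circ\mu_f-\mu_f\circ\delta\in D_P^{m-1}\text{ for all } f\in P\}$, where $\mu_f$ is multiplication by $f$. The ideal $I_{\mathbb{X}}^{\mathrm{diff}}:=\{f\in P\mid\delta(f)\in I_{\mathbb{X}}\text{ for all }\delta\in D_P^1\}$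 is saturated and homogeneous; the 0-dimensional scheme $\mathbb{Y}$ with $I_{\mathbb{Y}}=I_{\mathbb{X}}^{\mathrm{diff}}$ is the differential fattening of $\mathbb{X}$. Fat point scheme: for distinct $K$-rational points $p_1,\dots,p_s\in\mathbb{P}^n_K$ with homogeneous prime ideals $\mathfrak{p}_1,\dots,\mathfrak{p}_s\subseteq P$ and integers $m_1,\dots,m_s\ge1$, $\mathbb{X}=m_1p_1+\cdots+m_sp_s$ is the scheme with $I_{\mathbb{X}}=\mathfrak{p}_1^{m_1}\cap\cdots\cap\mathfrak{p}_s^{m_s}$. Convention: if $p=0$, then $p\nmid m_j$ for all $j$ (so the second sum in (b)(i) is empty). *)

(* Defs.v *)
From HB Require Import structures.
From mathcomp Require Import all_boot all_order all_algebra.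
From mathcomp Require Import separable.
From mathcomp Require Import boolp classical_sets.
From mathcomp Require Import freeg mpoly.

Set Implicit Arguments.
Unset Strict Implicit.
Unset Printing Implicit Defensive.

Import Order.TTheory GRing.Theory Num.Theory.

Local Open Scope ring_scope.
Local Open Scope quotient_scope.

Definition perfect_field (K : fieldType) : Prop :=
  forall q : {poly K}, irreducible_poly q -> separable_poly q.

Definition characteristic (K : fieldType) (p : nat) : Prop :=
  p \in [pchar K] \/ p = 0%N /\ [pchar K] =i pred0.

Section Ideals.
Variables (K : fieldType) (n : nat).
Local Notation P := {mpoly K[n.+1]}.
Implicit Types (I : idealr P) (p q : prime_idealr P).

Definition poly_piece (i : int) (f : P) : Prop :=
  if i is Posz d then f \is d.-homog else f = 0.

Definition homog_ideal I : Prop :=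
  forall f d, f \in I -> pihomog mdeg d f \in I.

(* [I] contains every [f] such that [M ^ k * f] is contained in [I] for some
   [k], where [M] is the ideal generated by the variables. *)
Definition saturated_ideal I : Prop :=
  forall f k,
    (forall m : 'X_{1..n.+1}, mdeg m = k -> 'X_[m] * f \in I) -> f \in I.

(* The points of Proj P: homogeneous primes not containing all variables. *)
Definition proj_point p : Prop :=
  homog_ideal p /\ exists i, ('X_i : P) \notin p.

Definition in_support I p : Prop := proj_point p /\ {subset I <= p}.

(* The closed subset V(I) of Proj P has Krull dimension 0: it is nonempty and
   contains no proper specialization. *)
Definition zero_dimensional I : Prop :=
  (exists p, in_support I p) /\
  forall p q, in_support I p -> in_support I q -> {subset p <= q} -> p =i q.

Definition scheme0_ideal I : Prop :=
  [/\ homog_ideal I, saturated_ideal I & zero_dimensional I].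

Definition avoids_X0 I : Prop :=
  forall p, in_support I p -> ('X_ord0 : P) \notin p.

(* The homogeneous prime ideal of the rational point with coordinates [x] is
   generated by the forms vanishing at [x]; equivalently, all homogeneous
   components of [f] vanish at [x]. Asking only that [f] vanish on the line
   through [x] would be too weak over a finite field. *)
Definition point_ideal (x : 'I_n.+1 -> K) (f : P) : Prop :=
  forall d, (pihomog mdeg d f).@[x] = 0.

Definition ideal_power (J : P -> Prop) (m : nat) (f : P) : Prop :=
  exists (N : nat) (h : 'I_N -> P) (g : 'I_N -> 'I_m -> P),
    (forall k j, J (g k j)) /\ f = \sum_(k < N) h k * \prod_(j < m) g k j.

(* [x j] are homogeneous coordinates of distinct rational points. *)
Definition distinct_points (s : nat) (x : 'I_s -> 'I_n.+1 -> K) : Prop :=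
  (forall j, exists i, x j i != 0) /\
  (forall j k, (exists2 c : K, c != 0 & forall i, x j i = c * x k i) -> j = k).

Definition fat_point_ideal (s : nat) (x : 'I_s -> 'I_n.+1 -> K)
    (m : 'I_s -> nat) (f : P) : Prop :=
  forall j, ideal_power (point_ideal (x j)) (m j) f.

End Ideals.

Section DiffOp.
Variables (K : fieldType) (n : nat).
Local Notation P := {mpoly K[n.+1]}.

Fixpoint diff_op (m : nat) (D : P -> P) : Prop :=
  if m is m'.+1 then
    linear D /\ forall f, diff_op m' (fun g => D (f * g) - f * D g)
  else forall a f g, D (a * f + g) = a * D f + D g.

Definition diff_ideal (I : idealr P) : pred P :=
  fun f => `[< forall D, diff_op 1 D -> D f \in I >].

Lemma diff_ideal_closed (I : idealr P) : idealr_closed (diff_ideal I).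
Proof.
have D0 (D : P -> P) : diff_op 0 D -> diff_op 1 D.
  move=> DP; split=> [c f g|f a g h]; first by rewrite -!mul_mpolyC DP.
  by rewrite mulrDr mulrCA !DP mulrDr mulrCA opprD addrACA -mulrBr.
split=> [||a u v /asboolP Iu /asboolP Iv].
- apply/asboolP=> D [DK _]; have := DK 1 0 0.
  by rewrite !scale1r addr0 -{1}[D 0]addr0 => /addrI <-; exact: rpred0.
- apply/negP => /asboolP /(_ id) H.
  by have := H (D0 _ (fun _ _ _ => erefl)); rewrite idealr1.
- apply/asboolP=> D D1; have [DK Dc] := D1.
  have -> : D (a * u + v) = D (a * u) + D v.
    by have := DK 1 (a * u) v; rewrite !scale1r.
  apply: rpredD; last exact: Iv.
  rewrite -[D _](subrK (a * D u)); apply: rpredD; last exact/idealMr/Iu.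
  exact: (Iu (fun g => D (a * g) - a * D g)) (D0 _ (Dc a)).
Qed.

HB.instance Definition _ (I : idealr P) :=
  isIdealr.Build P (diff_ideal I) (diff_ideal_closed I).

End DiffOp.

Section Kaehler.
Variables (K : fieldType) (R : comNzRingType) (iota : {rmorphism K -> R}).

Definition derivation (M : lmodType R) (D : R -> M) : Prop :=
  [/\ forall a b, D (a + b) = D a + D b,
      forall a b, D (a * b) = a *: D b + b *: D a
    & forall c, D (iota c) = 0].

Local Notation F := {freeg R / R}.

Definition dsym (a : R) : F := << a >>.

Definition kaehler_rel (w : F) : Prop :=
  [\/ exists a b, w = dsym (a + b) - (dsym a + dsym b),
      exists a b, w = dsym (a * b) - (a *: dsym b + b *: dsym a)
    | exists c, w = dsym (iota c)].

Definition kaehler_sub : {pred F} := fun w =>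
  `[< forall W : pred F, submod_closed W ->
      (forall r, kaehler_rel r -> W r) -> W w >].

Lemma kaehler_sub_closed : submod_closed kaehler_sub.
Proof.
split=> [|a u v /asboolP Su /asboolP Sv].
  by apply/asboolP => W [].
by apply/asboolP => W Wc Wr; case: (Wc) => _; apply; [apply: Su | apply: Sv].
Qed.

HB.instance Definition _ :=
  GRing.isZmodClosed.Build F kaehler_sub (GRing.submod_closedB kaehler_sub_closed).

Definition Omega := Quotient.quot kaehler_sub.

HB.instance Definition _ := ZmodQuotient.on Omega.

Definition omega_scale (a : R) : Omega -> Omega :=
  lift_op1 Omega (fun w : F => a *: w).

Lemma pi_omega_scale a : {morph \pi_Omega : w / a *: w >-> omega_scale a w}.
Proof.
move=> w; unlock omega_scale; apply/eqP; rewrite piE Quotient.equivE -scalerBr.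
have: w - repr (\pi_Omega w) \in kaehler_sub by rewrite Quotient.idealrBE reprK.
case: kaehler_sub_closed => S0 SP Sw.
by rewrite -[_ *: _]addr0; exact: SP.
Qed.

Fact omega_scaleA a b w :
  omega_scale a (omega_scale b w) = omega_scale (a * b) w.
Proof. by rewrite -[w]reprK -!pi_omega_scale scalerA. Qed.

Fact omega_scale1 : left_id 1 omega_scale.
Proof. by move=> w; rewrite -[w]reprK -pi_omega_scale scale1r. Qed.

Fact omega_scaleDr : right_distributive omega_scale +%R.
Proof.
move=> a u v; rewrite -[u]reprK -[v]reprK -raddfD -!pi_omega_scale.
by rewrite scalerDr raddfD.
Qed.

Fact omega_scaleDl w : {morph omega_scale^~ w : a b / a + b}.
Proof.
by move=> a b; rewrite -[w]reprK -!pi_omega_scale scalerDl raddfD.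
Qed.

HB.instance Definition _ := GRing.Zmodule_isLmodule.Build R Omega
  omega_scaleA omega_scale1 omega_scaleDr omega_scaleDl.

Lemma pi_omegaZ a (w : F) : \pi_Omega (a *: w) = a *: (\pi_Omega w : Omega).
Proof. exact: pi_omega_scale. Qed.

Definition kaehler_d (a : R) : Omega := \pi_Omega (dsym a).

Lemma pi_omega_eq0 (w : F) : (\pi_Omega w == 0) = (w \in kaehler_sub).
Proof. by rewrite -(raddf0 \pi_Omega) -Quotient.idealrBE subr0. Qed.

Lemma kaehler_pi0 (w : F) : kaehler_rel w -> \pi_Omega w = 0.
Proof.
by move=> rw; apply/eqP; rewrite pi_omega_eq0; apply/asboolP => W _; apply.
Qed.

Lemma kaehler_d_derivation : derivation kaehler_d.
Proof.
split=> [a b|a b|c].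
- apply/eqP; rewrite -subr_eq0 -raddfD -raddfB; apply/eqP/kaehler_pi0.
  by apply: Or31; exists a, b.
- apply/eqP; rewrite -subr_eq0 -!pi_omegaZ -raddfD -raddfB.
  by apply/eqP/kaehler_pi0; apply: Or32; exists a, b.
- by apply: kaehler_pi0; apply: Or33; exists c.
Qed.

Section Universal.
Variables (M : lmodType R) (D : R -> M).
Hypothesis derD : derivation D.

Local Notation lift := (fglift D : F -> M).

Let lift_scale a (w : F) : lift (a *: w) = a *: lift w.
Proof.
have addl := lift_is_additive D.
pose h := GRing.isZmodMorphism.Build F M lift addl.
pose l : {additive F -> M} := HB.pack lift h.
have lw : l w = \sum_(x <- dom w) coeff x w *: D x.
  rewrite -{1}(freeg_sumE w) raddf_sum.
  by apply: eq_bigr => x _; rewrite /= liftU.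
rewrite -[LHS]/(l _) -[fglift D w]/(l w) lw scaler_sumr.
have -> : a *: w = \sum_(x <- dom w) << a * coeff x w *g x >> by [].
rewrite raddf_sum; apply: eq_bigr => x _.
by rewrite /= liftU scalerA.
Qed.

Let lift_linear : linear lift.
Proof.
move=> a u v; rewrite -lift_scale.
have addl := lift_is_additive D.
pose h := GRing.isZmodMorphism.Build F M lift addl.
pose l : {additive F -> M} := HB.pack lift h.
exact: (raddfD l).
Qed.

Let l : {linear F -> M} :=
  HB.pack lift (GRing.isLinear.Build R F M *:%R lift lift_linear).

Let lift_sub w : w \in kaehler_sub -> lift w = 0.
Proof.
move=> /asboolP /(_ [pred w | l w == 0]) Sw; apply/eqP/Sw.
  split=> [|a u v /eqP lu /eqP lv]; first by rewrite inE raddf0.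
  by rewrite inE linearP lu lv scaler0 addr0.
case: derD => DD DM DC.
have lU a : l (dsym a) = D a by rewrite /= liftU scale1r.
have lD u v : l (u + v) = l u + l v by exact: raddfD.
have lB u v : l (u - v) = l u - l v by exact: raddfB.
have lZ a u : l (a *: u) = a *: l u by exact: lift_scale.
move=> r rr; apply/eqP; change (l r = 0).
case: rr => [[a [b ->]]|[a [b ->]]|[c ->]].
- by rewrite lB lD !lU DD subrr.
- by rewrite lB lD !lZ !lU DM subrr.
- by rewrite lU DC.
Qed.

Let h (w : Omega) : M := lift (repr w).

Let h_pi (w : F) : h (\pi_Omega w) = lift w.
Proof.
apply/eqP; rewrite -subr_eq0 /h -![fglift D _]/(l _) -raddfB.
by apply/eqP/lift_sub; rewrite Quotient.idealrBE reprK.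
Qed.

Let h_linear : linear h.
Proof.
move=> a u v; rewrite -[u]reprK -[v]reprK -pi_omegaZ -raddfD !h_pi.
exact: lift_linear.
Qed.

Lemma kaehler_universal :
  exists2 g : {linear Omega -> M}, (forall a, g (kaehler_d a) = D a)
    & forall g' : {linear Omega -> M},
        (forall a, g' (kaehler_d a) = D a) -> g' =1 g.
Proof.
pose g : {linear Omega -> M} :=
  HB.pack h (GRing.isLinear.Build R Omega M *:%R h h_linear).
have gd a : g (kaehler_d a) = D a by rewrite /= h_pi liftU scale1r.
exists g => // g' g'd w; rewrite -[w]reprK -(freeg_sumE (repr w)).
rewrite !raddf_sum; apply: eq_bigr => x _; set c := coeff _ _.
have pic : \pi_Omega << c *g x >> = c *: kaehler_d x :> Omega.
  rewrite /kaehler_d -pi_omegaZ; congr \pi_Omega.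
  by apply/eqP/freeg_eqP => y; rewrite coeffZ !coeffU mul1r.
transitivity (g' (c *: kaehler_d x)); first by congr (g' _).
by rewrite linearZ g'd -gd -linearZ; congr (g _).
Qed.

End Universal.

End Kaehler.

Section Hilbert.
Variables (K : fieldType) (R : comNzRingType) (iota : {rmorphism K -> R}).

(* [V] is meant to be a K-subspace of [M]; then [b] is a K-basis of [V]. *)
Definition has_kdim (M : lmodType R) (V : M -> Prop) (d : nat) : Prop :=
  exists2 b : 'I_d -> M, forall k, V (b k) &
    forall v, V v -> exists! c : 'rV[K]_d, v = \sum_k iota (c 0 k) *: b k.

(* The values of [xget] below are meaningless when nothing satisfies the
   characterization: infinite dimension, no Hilbert polynomial, no minimum. *)
Definition kdim (M : lmodType R) (V : M -> Prop) : nat :=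
  xget 0%N [set d | has_kdim V d]%classic.

(* [piece i] is the component of degree [i] of the graded module [M]. *)
Definition HF (M : lmodType R) (piece : int -> M -> Prop) (i : int) : nat :=
  kdim (piece i).

End Hilbert.

Definition is_HP (hf : int -> nat) (q : {poly rat}) : Prop :=
  exists i0 : int, forall i, i0 <= i -> (hf i)%:R = q.[i%:~R].

Definition HP (hf : int -> nat) : {poly rat} :=
  xget 0 [set q | is_HP hf q]%classic.

Definition agrees_from (hf : int -> nat) (i : int) : Prop :=
  forall j, i <= j -> (hf j)%:R = (HP hf).[j%:~R].

Definition ri (hf : int -> nat) : int :=
  xget 0 [set i | agrees_from hf i /\ forall k, agrees_from hf k -> i <= k]%classic.

Section CoordinateRing.
Variables (K : fieldType) (n : nat).
Local Notation P := {mpoly K[n.+1]}.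
Variable I : idealr P.

Definition coord_ring : comNzRingType := {ideal_quot I}.

Definition coord_proj : {rmorphism P -> coord_ring} := \pi_({ideal_quot I}).

Definition coord_const : {rmorphism K -> coord_ring} :=
  coord_proj \o @mpolyC n.+1 K.

Definition coord_piece (i : int) (a : coord_ring^o) : Prop :=
  exists2 f : P, poly_piece i f & a = coord_proj f.

Definition HF_scheme : int -> nat := HF coord_const coord_piece.

(* The value of a constant Hilbert polynomial. *)
Definition deg_scheme : rat := (HP HF_scheme)`_0.

Definition Omega_coord : lmodType coord_ring := Omega coord_const.

(* The grading with deg (d x_j) = 1, where the d x_j generate the module of
   differentials. *)
Definition Omega_piece (i : int) (w : Omega_coord) : Prop :=
  exists2 r : 'I_n.+1 -> coord_ring, forall j, coord_piece (i - 1) (r j) &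
    w = \sum_j r j *: kaehler_d coord_const (coord_proj 'X_j).

Definition HF_Omega : int -> nat := HF coord_const Omega_piece.

End CoordinateRing.

(* Main.v *)
(* In degree d + 1 the module of differentials is the cokernel of the gradient
   I_(d+1) -> R_d^(n+1), and the kernel of the gradient is the degree d + 1 part
   of the differential ideal; this gives the Hilbert function. Since X_0 does
   not vanish on the support, the powers of all variables eventually lie in
   I + (X_0), so multiplication by X_0 is eventually onto and the Hilbert
   function of R is eventually nonincreasing, hence constant; the differential
   ideal has the same support. For fat points, membership of a form in I or in
   its differential ideal means the vanishing of certain Taylor coefficients at
   the points: those of order below m_j for I, and for the differential ideal
   also those of order m_j at exponents not all divisible by p. In large degree
   the Taylor coefficients up to a given order can be prescribed arbitrarily,
   so the degrees count these coefficients. *)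
Require Import Defs.
From HB Require Import structures.
From mathcomp Require Import all_boot all_order all_algebra.
From mathcomp Require Import boolp classical_sets.
From mathcomp Require Import freeg mpoly.
(* [freeg] shadows [fintype.lift]. *)
From mathcomp Require Import fintype.
From mathcomp Require Import lra zify.

Set Implicit Arguments.
Unset Strict Implicit.
Unset Printing Implicit Defensive.

Import Order.TTheory GRing.Theory Num.Theory.
Local Open Scope ring_scope.
Local Open Scope quotient_scope.

(** * Dimensions of graded pieces *)

Section Subspaces.
Variables (K : fieldType) (vT : vectType K).

Lemma vspace_of_closed (S : vT -> Prop) :
  S 0 -> (forall a u v, S u -> S v -> S (a *: u + v)) ->
  exists U : {vspace vT}, forall v, v \in U <-> S v.
Proof.
move=> S0 SP.
suff H k (U : {vspace vT}) : (\dim {:vT} - \dim U <= k)%N ->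
    (forall v, v \in U -> S v) ->
    exists U : {vspace vT}, forall v, v \in U <-> S v.
  by apply: (H _ 0%VS (leqnn _)) => v; rewrite memv0 => /eqP ->.
elim: k U => [|k IH] U Uk US.
  exists U => v; split=> [/US //|_].
  suff -> : U = fullv by rewrite memvf.
  by apply/eqP; rewrite eqEdim subvf /= -subn_eq0 -leqn0.
have [[v Sv Uv]|noS] := pselect (exists2 v, S v & v \notin U); last first.
  exists U => v; split=> [/US //|Sv].
  by apply: contrapT => /negP Uv; apply: noS; exists v.
apply: (IH (U + <[v]>)%VS) => [|w /memv_addP [u Uu [x /vlineP [a ->] ->]]].
  have: (\dim U < \dim (U + <[v]>))%N.
    rewrite ltnNge; apply/negP => le; have: U == (U + <[v]>)%VS.
      by rewrite eqEdim addvSl.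
    move/eqP => E; move/negP: Uv; apply; rewrite E.
    by rewrite memvE addvSr.
  by move: Uk; lia.
by rewrite addrC; apply: SP => //; apply: US.
Qed.

Definition vspace_of (S : vT -> Prop) : {vspace vT} :=
  xget 0%VS [set U : {vspace vT} | forall v, v \in U <-> S v]%classic.

Lemma vspace_ofP (S : vT -> Prop) :
  S 0 -> (forall a u v, S u -> S v -> S (a *: u + v)) ->
  forall v, v \in vspace_of S <-> S v.
Proof.
move=> S0 SP; rewrite /vspace_of.
have [U US] := vspace_of_closed S0 SP.
pose A := [set U : {vspace vT} | forall v, v \in U <-> S v]%classic.
exact: (@xgetPex _ 0%VS A (ex_intro _ U US)).
Qed.

End Subspaces.

Section KDim.
Variables (K : fieldType) (R : comNzRingType) (iota : {rmorphism K -> R}).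
Variables (M : lmodType R).
Implicit Type V : M -> Prop.

Lemma has_kdim_le V d e : has_kdim iota V d -> has_kdim iota V e -> (d <= e)%N.
Proof.
move=> [b Vb bP] [b' Vb' bP'].
have [A AP] : exists A : 'M[K]_(d, e),
    forall k, b k = \sum_j iota (A k j) *: b' j.
  have /choice [f fP] : forall k, exists c : 'rV[K]_e,
    b k = \sum_j iota (c 0 j) *: b' j by move=> k; have [c []] := bP' _ (Vb k); exists c.
  by exists (\matrix_(k, j) f k 0 j) => k; rewrite fP; apply: eq_bigr => j _; rewrite mxE.
have [B BP] : exists B : 'M[K]_(e, d),
    forall k, b' k = \sum_j iota (B k j) *: b j.
  have /choice [f fP] : forall k, exists c : 'rV[K]_d,
    b' k = \sum_j iota (c 0 j) *: b j by move=> k; have [c []] := bP _ (Vb' k); exists c.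
  by exists (\matrix_(k, j) f k 0 j) => k; rewrite fP; apply: eq_bigr => j _; rewrite mxE.
suff AB : A *m B = 1%:M.
  by rewrite -[d](mxrank1 K) -AB (leq_trans (mxrankM_maxl _ _)) // rank_leq_col.
apply/row_matrixP => k; have [c [_ cP]] := bP _ (Vb k).
transitivity c; [apply/esym|]; apply: cP.
  rewrite {1}AP; under eq_bigr => j _ do rewrite BP scaler_sumr.
  rewrite exchange_big; apply: eq_bigr => i _ /=.
  rewrite !mxE rmorph_sum scaler_suml; apply: eq_bigr => j _.
  by rewrite scalerA -rmorphM.
rewrite (bigD1 k) //= big1 => [|j jk]; first by rewrite !mxE eqxx rmorph1 scale1r addr0.
by rewrite !mxE eq_sym (negbTE jk) rmorph0 scale0r.
Qed.

Lemma kdimE V d : has_kdim iota V d -> kdim iota V = d.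
Proof.
move=> Vd; have Vk : has_kdim iota V (kdim iota V).
  exact: (@xgetPex _ 0%N [set d | has_kdim iota V d]%classic (ex_intro _ d Vd)).
by apply/eqP; rewrite eqn_leq !(has_kdim_le (V := V)).
Qed.

Lemma kdim_image V (vT : vectType K) (phi : vT -> M) (U : {vspace vT}) :
  (forall a u v, phi (a *: u + v) = iota a *: phi u + phi v) ->
  (forall w, V w <-> exists u, w = phi u) ->
  (forall u, u \in U <-> phi u = 0) ->
  kdim iota V = (\dim {:vT} - \dim U)%N.
Proof.
move=> phiP VP UP; apply: kdimE; rewrite -dimv_compl.
have phiD u v : phi (u + v) = phi u + phi v.
  by have := phiP 1 u v; rewrite rmorph1 !scale1r.
have phi0 : phi 0 = 0 by apply/UP; rewrite mem0v.
have phiZ a u : phi (a *: u) = iota a *: phi u.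
  by have := phiP a u 0; rewrite phi0 !addr0.
have phi_sum d (F : 'I_d -> vT) : phi (\sum_i F i) = \sum_i phi (F i).
  exact: (big_morph phi phiD phi0).
set X := vbasis U^C; have Xb : basis_of U^C X := vbasisP _.
exists (fun k => phi X`_k) => [k|v /VP [u ->]]; first by apply/VP; exists X`_k.
have: u \in (U + U^C)%VS by rewrite addv_complf memvf.
case/memv_addP => u1 Uu1 [u2 Uu2 ->].
rewrite phiD (proj1 (UP u1) Uu1) add0r (coord_basis Xb Uu2).
exists (\row_k coord X k u2); split=> [|c].
  by rewrite phi_sum; apply: eq_bigr => i _; rewrite phiZ mxE.
have -> : \sum_k iota (c 0 k) *: phi X`_k = phi (\sum_k c 0 k *: X`_k).
  by rewrite phi_sum; apply: eq_bigr => i _; rewrite phiZ.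
move=> E; apply/rowP => k; rewrite mxE.
set s := \sum_i c 0 i *: X`_i in E; set t := \sum_i _ in E.
have Us : s \in U^C%VS.
  by rewrite memv_suml // => i _; rewrite memvZ // (basis_mem Xb) // mem_nth // size_tuple.
have Ut : t \in U^C%VS.
  by rewrite memv_suml // => i _; rewrite memvZ // (basis_mem Xb) // mem_nth // size_tuple.
have: t - s \in (U :&: U^C)%VS.
  rewrite memv_cap; apply/andP; split; last exact: memvB.
  apply/UP.
  by rewrite addrC -scaleN1r phiP E rmorphN1 scaleN1r addNr.
rewrite capv_compl memv0 subr_eq0 => /eqP ts.
have <- : coord X k t = coord X k u2 by rewrite /t -(coord_basis Xb Uu2).
by rewrite ts coord_sum_free // (basis_free Xb).
Qed.

End KDim.

(** * Derivations of polynomial rings *)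

Section Derivations.
Variables (K : fieldType) (n : nat).
Local Notation P := {mpoly K[n]}.

Lemma mpoly_alg_ind (Q : P -> Prop) :
  (forall c, Q c%:MP) -> (forall i, Q 'X_i) ->
  (forall f g, Q f -> Q g -> Q (f + g)) ->
  (forall f g, Q f -> Q g -> Q (f * g)) -> forall f, Q f.
Proof.
move=> QC QX QD QM; elim/mpolyind => [|c m f _ _ Qf].
  by rewrite -mpolyC0; apply: QC.
apply: (QD) => //; rewrite -mul_mpolyC; apply: (QM) => //.
rewrite mpolyXE_id; apply: (big_ind Q) => [||i _].
- by rewrite -mpolyC1; apply: QC.
- exact: QM.
elim: (m i) => [|k IH]; first by rewrite expr0 -mpolyC1; apply: QC.
by rewrite exprS; apply: QM.
Qed.

Lemma derivation_mpolyE (S : comNzRingType) (pi : {rmorphism P -> S})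
    (M : lmodType S) (E : P -> M) :
  (forall f g, E (f + g) = E f + E g) ->
  (forall f g, E (f * g) = pi f *: E g + pi g *: E f) ->
  (forall c, E c%:MP = 0) ->
  forall f, E f = \sum_j pi f^`M(j) *: E 'X_j.
Proof.
move=> ED EM EC; elim/mpoly_alg_ind => [c|i|f g IHf IHg|f g IHf IHg].
- by rewrite EC big1 // => j _; rewrite mderivC rmorph0 scale0r.
- rewrite (bigD1 i) //= big1 => [|j ji].
    rewrite mderivX mnm1E eqxx addr0.
    have -> : (U_(i) - U_(i) = 0 :> 'X_{1..n})%MM.
      by apply/mnmP => k; rewrite mnmBE mnm0E subnn.
    by rewrite mpolyX0 scale1r rmorph1 scale1r.
  by rewrite mderivX mnm1E eq_sym (negbTE ji) scale0r rmorph0 scale0r.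
- rewrite ED IHf IHg -big_split /=; apply: eq_bigr => j _.
  by rewrite mderivD rmorphD scalerDl.
- rewrite EM IHf IHg !scaler_sumr -big_split /=; apply: eq_bigr => j _.
  by rewrite mderivM rmorphD !rmorphM scalerDl !scalerA addrC [pi g * _]mulrC.
Qed.

Lemma mcoeff_pihomog d (f : P) m :
  (pihomog mdeg d f)@_m = if mdeg m == d then f@_m else 0.
Proof.
rewrite pihomogE raddf_sum /=.
have [md|md] := ifPn; last first.
  rewrite big1 // => k /eqP kd; rewrite mcoeffZ mcoeffX.
  by case: eqP => [km|]; rewrite ?mulr0 //; move: md; rewrite -km kd eqxx.
have [fm|fm] := boolP (m \in msupp f); last first.
  rewrite memN_msupp_eq0 // big_seq_cond big1 // => k /andP [kf _].
  rewrite mcoeffZ mcoeffX; case: eqP => [km|]; rewrite ?mulr0 //.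
  by move: fm; rewrite -km kf.
rewrite big_mkcond (bigD1_seq m) ?msupp_uniq //= md mcoeffZ mcoeffX eqxx mulr1.
rewrite big1 ?addr0 // => k km; case: ifP => // _.
by rewrite mcoeffZ mcoeffX (negbTE km) mulr0.
Qed.

Lemma mderiv_pihomogS d i (f : P) :
  (pihomog mdeg d.+1 f)^`M(i) = pihomog mdeg d f^`M(i).
Proof.
apply/mpolyP => m; rewrite mcoeff_mderiv !mcoeff_pihomog mcoeff_mderiv.
by rewrite mdegD mdeg1 addn1 eqSS; case: ifP => // _; rewrite mul0rn.
Qed.

Lemma mderiv_pihomog0 i (f : P) : (pihomog mdeg 0 f)^`M(i) = 0.
Proof.
apply/mpolyP => m; rewrite mcoeff_mderiv !mcoeff_pihomog mcoeff0.
by rewrite mdegD mdeg1 addn1 mul0rn.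
Qed.

Lemma mderiv_homogS d i (f : P) : f \is d.+1.-homog -> f^`M(i) \is d.-homog.
Proof. by move=> fd; rewrite -(pihomog_dE fd) mderiv_pihomogS pihomogP. Qed.

Lemma mderiv_homog0 i (f : P) : f \is 0.-homog -> f^`M(i) = 0.
Proof. by move=> fd; rewrite -(pihomog_dE fd) mderiv_pihomog0. Qed.

Lemma homog_euler d (f : P) :
  f \is d.-homog -> \sum_i 'X_i * f^`M(i) = d%:R * f.
Proof.
move=> fd; rewrite [in RHS](mpolyE f) mulr_sumr.
transitivity (\sum_i \sum_(m <- msupp f) 'X_i * (f@_m *: 'X_[m])^`M(i)).
  by apply: eq_bigr => i _; rewrite {1}(mpolyE f) raddf_sum mulr_sumr.
rewrite exchange_big; apply: eq_big_seq => m mf /=.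
have {mf fd}<- : mdeg m = d by exact: (dhomog_mf fd).
rewrite mdegE natr_sum mulr_suml; apply: eq_bigr => i _.
rewrite mderivZ mderivX -!scalerAr; congr (_ *: _).
have [->|mi] := eqVneq (m i) 0%N; first by rewrite scale0r mul0r.
rewrite -mpolyXD addmC submK ?lep1mP //.
by rewrite -mul_mpolyC mpolyC_nat.
Qed.

End Derivations.

Section DiffIdeal.
Variables (K : fieldType) (n : nat).
Local Notation P := {mpoly K[n.+1]}.
Implicit Types (I : idealr P) (f : P).

Lemma diff_op1E (D : P -> P) : diff_op 1 D ->
  forall f, D f = f * D 1 + \sum_j f^`M(j) * (D 'X_j - 'X_j * D 1).
Proof.
move=> [Dlin D0] f.
have dbl0 (x : P) : x = x + x -> x = 0.
  by move/eqP; rewrite -{1}[x]addr0 (inj_eq (addrI x)) eq_sym => /eqP.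
have Dcomm g h : D (g * h) - g * D h = h * (D g - g * D 1).
  have D0g := D0 g; have := D0g h 1 0; rewrite /= !addr0 !mulr1 => ->.
  suff -> : D (g * 0) - g * D 0 = 0 by rewrite addr0.
  by apply: dbl0; have := D0g 1 0 0; rewrite /= !mul1r addr0.
have DD g h : D (g + h) = D g + D h.
  by have := Dlin 1 g h; rewrite !scale1r.
have D_0 : D 0 = 0 by apply: dbl0; rewrite -DD addr0.
have DZ c g : D (c *: g) = c *: D g by have := Dlin c g 0; rewrite D_0 !addr0.
pose E g : P^o := D g - g * D 1.
have -> : \sum_j f^`M(j) * (D 'X_j - 'X_j * D 1) = E f; last first.
  by rewrite /E addrC subrK.
apply/esym/(derivation_mpolyE (pi := idfun) (E := E)); rewrite /E.
- by move=> g h; rewrite DD mulrDl opprD addrACA.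
- move=> g h /=; rewrite /GRing.scale /= -Dcomm mulrBr.
  by rewrite addrA subrK mulrA [h * g]mulrC.
- by move=> c; rewrite -[c%:MP]mulr1 mul_mpolyC DZ -scalerAl mul1r subrr.
Qed.

Lemma diff_op1_id : diff_op 1 (@id P).
Proof. by split=> [//|f] a g h; rewrite !subrr mulr0 addr0. Qed.

Lemma diff_op1_mderiv (i : 'I_n.+1) : diff_op 1 (mderiv i : P -> P).
Proof.
split=> [|f]; first exact: linearP.
by move=> a g h; rewrite /= !mderivM !addrK mulrDr mulrCA.
Qed.

Lemma diff_idealP I f :
  (f \in diff_ideal I) <-> f \in I /\ forall j, f^`M(j) \in I.
Proof.
split=> [/asboolP Df|[If dIf]].
  split=> [|j]; first exact: (Df id diff_op1_id).
  exact: (Df _ (diff_op1_mderiv j)).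
apply/asboolP => D /diff_op1E ->.
rewrite rpredD //; first by rewrite mulrC idealMr.
by rewrite rpred_sum // => j _; rewrite mulrC idealMr.
Qed.

Lemma diff_ideal_homog I : homog_ideal I -> homog_ideal (diff_ideal I).
Proof.
move=> hI f [|d] /diff_idealP [If dIf]; apply/diff_idealP; split=> [|j].
- exact: hI.
- by rewrite mderiv_pihomog0 rpred0.
- exact: hI.
- by rewrite mderiv_pihomogS; apply: hI.
Qed.

Lemma sqr_diff_ideal I f : f \in I -> f * f \in diff_ideal I.
Proof.
move=> If; apply/diff_idealP; split=> [|j]; first exact: idealMr.
by rewrite mderivM [f * _]mulrC rpredD ?idealMr.
Qed.

End DiffIdeal.

(** * Relations between differentials *)

Lemma fglift_linear (S : comNzRingType) (T : choiceType) (M : lmodType S)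
    (f : T -> M) : linear (fglift f : {freeg T / S} -> M).
Proof.
pose h := GRing.isZmodMorphism.Build _ _ (fglift f) (lift_is_additive f).
pose l : {additive {freeg T / S} -> M} := HB.pack (fglift f) h.
have lU c x : l << c *g x >> = c *: f x by exact: liftU.
move=> a u v; rewrite -![fglift f _]/(l _) raddfD; congr (_ + _).
rewrite -(freeg_sumE u) scaler_sumr [l (\sum_(z <- _) << _ *g _ >>)]raddf_sum.
rewrite scaler_sumr [LHS]raddf_sum.
apply: eq_bigr => x _; rewrite lU scalerA -lU; congr (l _).
by apply/eqP/freeg_eqP => y; rewrite coeffZ !coeffU mulrA.
Qed.

Section OmegaRelations.
Variables (K : fieldType) (n : nat) (I : idealr {mpoly K[n.+1]}).
Local Notation P := {mpoly K[n.+1]}.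
Local Notation R := (coord_ring I).
Local Notation pr := (coord_proj I).
Local Notation dR := (kaehler_d (coord_const I)).

Lemma coord_proj_eq f g : pr f = pr g <-> f - g \in I.
Proof. by rewrite Quotient.idealrBE; split=> [/eqP|/eqP]. Qed.

Lemma coord_proj_eq0 f : pr f = 0 <-> f \in I.
Proof. by rewrite -(rmorph0 pr) coord_proj_eq subr0. Qed.

Lemma coord_projK (a : R) : pr (repr a) = a.
Proof. exact: reprK. Qed.

Lemma kaehler_d_coord f : dR (pr f) = \sum_j pr f^`M(j) *: dR (pr 'X_j).
Proof.
have [dD dM dC] := kaehler_d_derivation (coord_const I).
apply: (derivation_mpolyE (pi := pr) (E := fun f => dR (pr f))) => [g h|g h|c].
- by rewrite rmorphD dD.
- by rewrite rmorphM dM.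
- exact: dC.
Qed.

(* The relations between the differentials of the variables are exactly the
   gradients of the elements of [I]. The gradient of the chosen representative
   [repr a] is well defined only up to such gradients, so it does not give a
   map on the module of differentials, but it does give one on the free module
   covering it. *)
Lemma omega_relations (r : 'I_n.+1 -> R) :
  \sum_j r j *: dR (pr 'X_j) = 0 <->
  exists2 f, f \in I & forall j, r j = pr f^`M(j).
Proof.
split=> [|[f If rf]]; last first.
  under eq_bigr do rewrite rf.
  rewrite -kaehler_d_coord (proj2 (coord_proj_eq0 f) If).
  have [_ _ dC] := kaehler_d_derivation (coord_const I).
  by have := dC 0; rewrite rmorph0.
pose grad f : 'rV[R]_n.+1 := \row_j pr f^`M(j).
have gradD f g : grad (f + g) = grad f + grad g.
  by apply/rowP => j; rewrite !mxE mderivD rmorphD.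
have gradB f g : grad (f - g) = grad f - grad g.
  by apply/rowP => j; rewrite !mxE mderivB rmorphB.
have gradM f g : grad (f * g) = pr f *: grad g + pr g *: grad f.
  by apply/rowP => j; rewrite !mxE mderivM rmorphD !rmorphM addrC [pr g * _]mulrC.
have gradC c : grad c%:MP = 0.
  by apply/rowP => j; rewrite !mxE mderivC rmorph0.
have gradMI a f : f \in I -> grad (a * f) = pr a *: grad f.
  by move=> If; rewrite gradM (proj2 (coord_proj_eq0 f) If) scale0r addr0.
pose N (v : 'rV[R]_n.+1) := exists2 f, f \in I & v = grad f.
have NP a u v : N u -> N v -> N (a *: u + v).
  move=> [f If ->] [g Ig ->]; exists (repr a * f + g).
    by rewrite rpredD ?idealMr.
  by rewrite gradD gradMI // coord_projK.
have N0 : N 0 by exists 0; rewrite ?rpred0 // -mpolyC0 gradC.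
pose D (a : R) := grad (repr a).
have DN f : N (D (pr f) - grad f).
  by exists (repr (pr f) - f); rewrite ?gradB //; apply/coord_proj_eq; exact: coord_projK.
pose l := fglift D : {freeg R / R} -> 'rV[R]_n.+1.
have llin : linear l by exact: fglift_linear.
have lD u v : l (u + v) = l u + l v by have := llin 1 u v; rewrite !scale1r.
have l0 : l 0 = 0 by apply: (@addrI _ (l 0)); rewrite -lD !addr0.
have lZ a u : l (a *: u) = a *: l u by have := llin a u 0; rewrite l0 !addr0.
have lB u v : l (u - v) = l u - l v by rewrite lD -scaleN1r lZ scaleN1r.
have lU a : l (dsym a) = D a by rewrite /l liftU scale1r.
have ND u v : N u -> N v -> N (u + v) by move=> Nu Nv; rewrite -[u]scale1r; apply: NP.
have NB u v : N u -> N v -> N (u - v).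
  by move=> Nu Nv; rewrite addrC -scaleN1r; apply: NP.
have lN w : w \in kaehler_sub (coord_const I) -> N (l w).
  move=> /asboolP /(_ (fun w => `[< N (l w) >])) H; apply/asboolP/H.
    split=> [|a u v /asboolP Nu /asboolP Nv]; apply/asboolP; first by rewrite l0.
    by rewrite llin; apply: NP.
  move=> _ [[a [b ->]]|[a [b ->]]|[c ->]]; apply/asboolP.
  - rewrite lB lD !lU -gradD.
    by have := DN (repr a + repr b); rewrite rmorphD !coord_projK.
  - rewrite lB lD !lZ !lU.
    have := DN (repr a * repr b); rewrite rmorphM !coord_projK gradM.
    by rewrite !coord_projK.
  - by rewrite lU; have := DN c%:MP; rewrite gradC subr0.
have -> : \sum_j r j *: dR (pr 'X_j) = \pi_(Omega (coord_const I)) (\sum_j r j *: dsym (pr 'X_j)).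
  apply/esym; elim/big_rec2: _ => [|j u v _ <-]; first exact: raddf0.
  rewrite -pi_omegaZ; exact: raddfD.
move/eqP; rewrite pi_omega_eq0 => /lN.
have -> : l (\sum_j r j *: dsym (pr 'X_j)) = \sum_j r j *: D (pr 'X_j).
  by rewrite (big_morph l lD l0); apply: eq_bigr => j _; rewrite lZ lU.
have Nr : N (\sum_j r j *: (D (pr 'X_j) - grad 'X_j)).
  by elim/big_rec: _ => [//|j v _ Nv]; apply: NP.
move/(fun h => NB _ _ h Nr); rewrite -sumrB.
under eq_bigr do rewrite -scalerBr opprB addrC subrK.
case=> f If E; exists f => // j.
move/rowP: E => /(_ j); rewrite [RHS]mxE => <-.
rewrite summxE (bigD1 j) //= big1 => [|k kj].
  rewrite !mxE mderivX mnm1E eqxx addr0 scale1r.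
  have -> : (U_(j) - U_(j) = 0 :> 'X_{1..n.+1})%MM.
    by apply/mnmP => k; rewrite mnmBE mnm0E subnn.
  by rewrite mpolyX0 rmorph1 mulr1.
by rewrite !mxE mderivX mnm1E (negbTE kj) scale0r rmorph0 mulr0.
Qed.

End OmegaRelations.

(** * Hilbert functions *)

Section HilbertFunctions.
Variables (K : fieldType) (n : nat).
Local Notation P := {mpoly K[n.+1]}.
Local Notation Pd := (dhomog n.+1 K).
Implicit Types (I : idealr P).

Definition homog_part I d : {vspace Pd d} := vspace_of (fun f : Pd d => (f : P) \in I).

Lemma homog_partP I d (f : Pd d) : reflect ((f : P) \in I) (f \in homog_part I d).
Proof.
have [] := @vspace_ofP K (Pd d) (fun f : Pd d => (f : P) \in I) _ _ f.
- exact: rpred0.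
- by move=> a u v Iu Iv; rewrite linearP /= -mul_mpolyC rpredD ?idealMr.
- by move=> fI If; apply: (iffP idP).
Qed.

Lemma HF_schemeE I (d : nat) :
  HF_scheme I d = (\dim {:Pd d} - \dim (homog_part I d))%N.
Proof.
apply: (kdim_image (phi := fun f : Pd d => coord_proj I f : (coord_ring I)^o)).
- by move=> a u v; rewrite linearP /= -mul_mpolyC rmorphD rmorphM.
- move=> w; split=> [[f fd ->]|[f ->]]; last first.
    by exists (f : P) => //; apply: dhomog_is_dhomog.
  by exists (DHomog fd).
- by move=> f; split=> [/homog_partP/coord_proj_eq0|/coord_proj_eq0/homog_partP].
Qed.

Lemma HF_scheme_neg I d : HF_scheme I (Negz d) = 0%N.
Proof.
rewrite -(subnn (\dim {: Pd 0})).
apply: (kdim_image (phi := fun=> 0 : (coord_ring I)^o)) => [a u v|w|u].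
- by rewrite scaler0 addr0.
- split=> [[f -> ->]|[_ ->]]; first by exists 0; rewrite rmorph0.
  by exists 0; rewrite ?rmorph0.
- by rewrite memvf.
Qed.

Lemma homog_part_diff_sub I d : (homog_part (diff_ideal I) d <= homog_part I d)%VS.
Proof. by apply/subvP => f /homog_partP /diff_idealP [If _]; apply/homog_partP. Qed.

Lemma homog_part_diff0 I : homog_part (diff_ideal I) 0 = homog_part I 0.
Proof.
apply/eqP; rewrite eqEsubv homog_part_diff_sub /=; apply/subvP => f /homog_partP If.
apply/homog_partP/diff_idealP; split=> // j.
rewrite mderiv_homog0 ?rpred0 //; exact: dhomog_is_dhomog.
Qed.

Lemma HF_Omega0 I : HF_Omega I 0 = 0%N.
Proof.
rewrite -(subnn (\dim {: Pd 0})).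
apply: (kdim_image (phi := fun=> 0 : Omega_coord I)) => [a u v|w|u].
- by rewrite scaler0 addr0.
- split=> [[r r0 ->]|[_ ->]].
    exists 0; apply: big1 => j _; have [f -> ->] := r0 j.
    by rewrite rmorph0 scale0r.
  exists (fun=> 0) => [j|]; first by exists 0; rewrite ?rmorph0.
  by rewrite big1 // => j _; rewrite scale0r.
- by rewrite memvf.
Qed.

Section Gradient.
Variable d : nat.

Definition partial (j : 'I_n.+1) (f : Pd d.+1) : Pd d :=
  DHomog (mderiv_homogS j (dhomog_is_dhomog f)).

Fact partial_linear j : linear (partial j).
Proof. by move=> a u v; apply/val_inj; rewrite /= mderivD mderivZ. Qed.
HB.instance Definition _ j :=
  GRing.isLinear.Build K (Pd d.+1) (Pd d) *:%R (partial j) (partial_linear j).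

Definition grad_mod (U : {vspace Pd d}) (f : Pd d.+1) : {ffun 'I_n.+1 -> subvs_of U^C} :=
  [ffun j => vsproj U^C (partial j f - projv U (partial j f))].

Fact grad_mod_linear U : linear (grad_mod U).
Proof.
move=> a u v; apply/ffunP => j; rewrite !ffunE -linearP /=; congr vsproj.
by rewrite !linearP /= scalerBr scalerN addrACA.
Qed.
HB.instance Definition _ U :=
  GRing.isLinear.Build K (Pd d.+1) {ffun 'I_n.+1 -> subvs_of U^C} *:%R
    (grad_mod U) (grad_mod_linear U).

Lemma grad_modE U f j :
  vsval (grad_mod U f j) = partial j f - projv U (partial j f).
Proof. by rewrite ffunE vsprojK // memv_projC. Qed.

End Gradient.

(* Lifting [R_d] to a complement of [I_d] in [P_d], the module of differentials
   in degree [d + 1] is the cokernel of the gradient [I_(d+1) -> R_d ^ (n+1)],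
   whose kernel is the degree [d + 1] part of the differential ideal. *)
Lemma HF_OmegaS I d : homog_ideal I ->
  (HF_Omega I d.+1 +
     (\dim (homog_part I d.+1) - \dim (homog_part (diff_ideal I) d.+1)) =
   n.+1 * HF_scheme I d)%N.
Proof.
move=> hI; set U := homog_part I d; set C := (U^C)%VS.
pose G := linfun (@grad_mod d U).
pose phi (u : {ffun 'I_n.+1 -> subvs_of C}) : Omega_coord I :=
  \sum_j coord_proj I (vsval (u j)) *: kaehler_d (coord_const I) (coord_proj I 'X_j).
have dimU : (\dim (homog_part I d.+1 :&: lker G) = \dim (homog_part (diff_ideal I) d.+1))%N.
  congr (\dim _); apply/vspaceP => f; rewrite memv_cap memv_ker lfunE.
  apply/andP/homog_partP => [[/homog_partP If /eqP Gf]|/diff_idealP [If dIf]].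
    apply/diff_idealP; split=> // j.
    have /eqP := grad_modE U f j; rewrite [grad_mod _ _]Gf ffunE eq_sym subr_eq0 => /eqP E.
    by have: partial j f \in U; [rewrite E memv_proj|move/homog_partP].
  split; first exact/homog_partP.
  apply/eqP/ffunP => j; apply/val_inj; rewrite [LHS]grad_modE ffunE.
  rewrite projv_id ?subrr //; exact/homog_partP/dIf.
have -> : (\dim (homog_part I d.+1) - \dim (homog_part (diff_ideal I) d.+1))%N =
    \dim (G @: homog_part I d.+1)%VS.
  by rewrite -(limg_ker_dim G (homog_part I d.+1)) dimU addKn.
have -> : (n.+1 * HF_scheme I d = \dim {: {ffun 'I_n.+1 -> subvs_of C}})%N.
  rewrite dimvf HF_schemeE -/U -dimv_compl -[RHS]/(#|'I_n.+1| * \dim C)%N.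
  by rewrite card_ord.
have projU (f : Pd d.+1) (g : Pd d) j : (g : P) - partial j f \in I ->
    g - (partial j f - projv U (partial j f)) \in U.
  move=> Ig; rewrite opprB addrCA addrC; apply: memvD; last exact: memv_proj.
  exact/homog_partP.
suff E : HF_Omega I d.+1 =
    (\dim {: {ffun 'I_n.+1 -> subvs_of C}} - \dim (G @: homog_part I d.+1))%N.
  by apply: etrans (congr1 (addn^~ _) E) _; rewrite subnK // dimvS // subvf.
apply: (kdim_image (phi := phi)) => [a u v|w|u].
- rewrite scaler_sumr -big_split /=; apply: eq_bigr => j _.
  by rewrite !ffunE linearP /= -mul_mpolyC rmorphD rmorphM scalerDl scalerA.
- split=> [[r rd ->]|[u ->]]; last first.
    exists (fun j => coord_proj I (vsval (u j))) => // j.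
    by rewrite intS [1 + _]addrC addrK; exists (vsval (u j) : P) => //; apply: dhomog_is_dhomog.
  have /choice [f fP] : forall j, exists f : Pd d, r j = coord_proj I f.
    move=> j; have := rd j; rewrite intS [1 + _]addrC addrK => -[f fd ->].
    by exists (DHomog fd).
  exists [ffun j => vsproj C (f j - projv U (f j))].
  apply: eq_bigr => j _; congr (_ *: _); rewrite fP ffunE vsprojK ?memv_projC //.
  apply/coord_proj_eq; rewrite /= opprB addrC subrK.
  by apply/homog_partP; rewrite memv_proj.
- rewrite omega_relations; split=> [/memv_imgP [f /homog_partP If ->]|[f If uf]].
    exists (f : P) => // j; apply/coord_proj_eq.
    rewrite lfunE grad_modE linearB /= addrAC subrr sub0r rpredN.
    by apply/homog_partP; rewrite memv_proj.
  pose f' : Pd d.+1 := DHomog (pihomogP mdeg d.+1 f).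
  apply/memv_imgP; exists f'; first exact/homog_partP/hI.
  apply/ffunP => j; apply/val_inj/eqP; rewrite lfunE /= -[X in _ == X]/(vsval (grad_mod U f' j)).
  rewrite grad_modE -subr_eq0 -memv0 -(capv_compl U) memv_cap.
  apply/andP; split; last by rewrite memvB ?subvsP ?memv_projC.
  apply: projU; rewrite /= mderiv_pihomogS.
  have := uf j; rewrite coord_proj_eq => /(hI _ d).
  by rewrite pihomogB pihomog_dE //; apply: dhomog_is_dhomog.
Qed.

Lemma dim_homog_part_le I d : (\dim (homog_part I d) <= \dim {:Pd d})%N.
Proof. exact/dimvS/subvf. Qed.

Lemma HF_OmegaE I (i : nat) : homog_ideal I ->
  (HF_Omega I i%:Z)%:Z =
    (n.+1)%:Z * (HF_scheme I (i%:Z - 1))%:Z + (HF_scheme I i%:Z)%:Z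
    - (HF_scheme (diff_ideal I) i%:Z)%:Z.
Proof.
move=> hI; case: i => [|d].
  rewrite HF_Omega0 (_ : 0%:Z - 1 = Negz 0) // HF_scheme_neg.
  by rewrite !HF_schemeE homog_part_diff0 mulr0 add0r subrr.
have -> : d.+1%:Z - 1 = d%:Z by rewrite intS [1 + _]addrC addrK.
have := HF_OmegaS d hI; rewrite !HF_schemeE.
have := dimvS (homog_part_diff_sub I d.+1).
have := dim_homog_part_le I d.+1; have := dim_homog_part_le I d.
lia.
Qed.

End HilbertFunctions.

(** * Stabilization of Hilbert functions *)

Section HomogeneousCore.
Variables (K : fieldType) (n : nat).
Local Notation P := {mpoly K[n]}.

Lemma pihomogMl e k (f g : P) : f \is e.-homog ->
  pihomog mdeg k (f * g) = if (e <= k)%N then f * pihomog mdeg (k - e) g else 0.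
Proof.
move=> fa; rewrite [in LHS](pihomog_partitionE (leqnn (msize g))) mulr_sumr raddf_sum /=.
have fg b : f * pihomog mdeg b g \is (e + b).-homog.
  by apply: dhomogM => //; apply: pihomogP.
have [ak|ka] := leqP e k; last first.
  apply: big1 => b _; apply: (pihomog_ne0 (d := (e + b)%N)); last exact: fg.
  by rewrite neq_ltn (leq_trans ka) ?orbT // leq_addr.
rewrite [in RHS](pihomog_partitionE (leqnn (msize g))) raddf_sum mulr_sumr /=.
apply: eq_bigr => b _; have [E|E] := eqVneq (k - e)%N b.
  by rewrite -E pihomog_id pihomog_dE // -{2}(subnKC ak); apply: fg.
rewrite [pihomog _ (k - e) _](pihomog_ne0 (d := b)) ?mulr0 ?pihomogP 1?eq_sym //.
apply: (pihomog_ne0 (d := (e + b)%N)); last exact: fg.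
by apply: contra E => /eqP <-; rewrite addKn.
Qed.

Lemma pihomogM k N (f g : P) : (msize f <= N)%N ->
  pihomog mdeg k (f * g) =
  \sum_(a < N) if (a <= k)%N then pihomog mdeg a f * pihomog mdeg (k - a) g else 0.
Proof.
move=> fN; rewrite {1}(pihomog_partitionE fN) mulr_suml raddf_sum /=.
by apply: eq_bigr => a _; rewrite (pihomogMl _ _ (pihomogP _ _ _)).
Qed.

Lemma homog_core_prime (A : P -> Prop) :
  A 0 -> (forall a u v, A u -> A v -> A (a * u + v)) -> ~ A 1 ->
  (forall u v, A (u * v) -> A u \/ A v) ->
  exists q : prime_idealr P, forall f, f \in q <-> forall d, A (pihomog mdeg d f).
Proof.
move=> A0 AP A1 Apr.
have AM a u : A u -> A (a * u) by move=> Au; rewrite -[_ * _]addr0; apply: AP.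
have AD u v : A u -> A v -> A (u + v) by move=> Au Av; rewrite -[u]mul1r; apply: AP.
have AB u v : A u -> A v -> A (u - v).
  by move=> Au Av; rewrite addrC -mulN1r; apply: AP.
pose q : pred P := fun f => `[< forall d, A (pihomog mdeg d f) >].
have qid : idealr_closed q.
  split=> [||a u v /asboolP Au /asboolP Av].
  - by apply/asboolP => d; rewrite raddf0.
  - by apply/asboolP => /(_ 0%N); rewrite pihomog_dE ?dhomog1.
  - apply/asboolP => d; rewrite pihomogD; apply/AD => //.
    rewrite (pihomogM _ _ (leqnn _)); elim/big_rec: _ => // i x _ Ax.
    by apply/AD => //; case: ifP => // _; apply: AM.
have qpr : prime_idealr_closed q.
  move=> u v /asboolP Auv; apply: contrapT => /negP; rewrite negb_or => /andP [].
  have low w : w \notin q -> exists d, ~ A (pihomog mdeg d w) /\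
      forall k, (k < d)%N -> A (pihomog mdeg k w).
    move=> /asboolPn /existsNP [d0 Ad0].
    have ex : exists d, `[< ~ A (pihomog mdeg d w) >] by exists d0; apply/asboolP.
    case: (ex_minnP ex) => d /asboolP Ad dmin; exists d; split=> // k kd.
    by apply: contrapT => Ak; move: kd; rewrite ltnNge dmin //; apply/asboolP.
  move=> /low [d [Ad lowd]] /low [e [Ae lowe]].
  have := Auv (d + e)%N; rewrite (pihomogM _ _ (leq_addr d.+1 (msize u))).
  have dN : (d < msize u + d.+1)%N by rewrite addnS ltnS leq_addl.
  rewrite (bigD1 (Ordinal dN)) //= leq_addr addKn => Asum.
  suff : A (pihomog mdeg d u * pihomog mdeg e v) by move=> /Apr [].
  rewrite -[X in A X](addrK (\sum_(i < msize u + d.+1 | i != Ordinal dN)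
    if (i <= d + e)%N then pihomog mdeg i u * pihomog mdeg (d + e - i) v else 0)).
  apply/AB => //; elim/big_rec: _ => // i x ne Ax; apply/AD => //.
  case: ifP => // ide; have {}ne : i <> d :> nat.
    by move=> E; move/eqP: ne; apply; apply: val_inj.
  have [id|di] := ltnP i d; first by rewrite mulrC; apply/AM/lowd.
  by apply/AM/lowe; lia.
pose m1 := isIdealr.Build P q qid.
pose m2 := isPrimeIdealrClosed.Build P q qpr.
pose Q : prime_idealr P := HB.pack q m1 m2.
by exists Q => f; split=> [/asboolP|Af] //; apply/asboolP.
Qed.

Lemma homog_core_homog (A : P -> Prop) f : A 0 ->
  (forall d, A (pihomog mdeg d f)) ->
  forall d e, A (pihomog mdeg e (pihomog mdeg d f)).
Proof.
move=> A0 Af d e; have [<-|ne] := eqVneq d e; first by rewrite pihomog_id.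
by rewrite (pihomog_ne0 (d := d)) ?pihomogP.
Qed.

End HomogeneousCore.

Section Support.
Variables (K : fieldType) (n : nat).
Local Notation P := {mpoly K[n.+1]}.
Implicit Types (J : idealr P).

(* Otherwise a maximal ideal among those containing [J] and ['X_0] but no power
   of ['X_i] would be prime, and its homogeneous core a point of the support of
   [J] on the hyperplane ['X_0 = 0]. *)
Lemma avoids_X0_power J i : homog_ideal J -> avoids_X0 J ->
  exists N u v, u \in J /\ 'X_i ^+ N = u + 'X_ord0 * v.
Proof.
move=> hJ JX0; apply: contrapT => noN.
pose ideal (A : set P) := A 0 /\ forall a u v, A u -> A v -> A (a * u + v).
pose J0 : set P := fun w => exists u v, u \in J /\ w = u + 'X_ord0 * v.
pose good A := [/\ ideal A, (J0 `<=` A)%classic & forall N, ~ A ('X_i ^+ N)].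
have J0good : good J0.
  split=> //; last first.
    by move=> N [u [v uv]]; apply: noN; exists N, u, v.
  split; first by exists 0, 0; rewrite rpred0 mulr0 addr0.
  move=> a _ _ [u [v [Ju ->]]] [u' [v' [Ju' ->]]].
  exists (a * u + u'), (a * v + v'); split; first by rewrite rpredD ?idealMr.
  by rewrite !mulrDr mulrCA addrACA.
have [F FP Ftot|A [AP Amax]] :=
    @Zorn_bigcup P (fun A => A = set0 \/ good A).
  have [[B FB Bgood]|noB] := pselect (exists2 B, F B & good B); last first.
    left; apply/seteqP; split=> // x [B FB Bx].
    have [B0|Bg] := FP _ FB; first by rewrite B0 in Bx.
    by case: noB; exists B.
  right; have Fgood C x : F C -> C x -> good C.
    by move=> /FP [->|].
  split.
  - split; first by exists B => //; case: Bgood => -[].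
    move=> a u v [C FC Cu] [D FD Dv].
    have [[_ CP] _ _] := Fgood _ _ FC Cu; have [[_ DP] _ _] := Fgood _ _ FD Dv.
    have [CD|DC] := Ftot _ _ FC FD.
      by exists D => //; apply/DP => //; apply: CD.
    by exists C => //; apply/CP => //; apply: DC.
  - by move=> x J0x; exists B => //; case: Bgood => _ + _; apply.
  - by move=> N [C FC CN]; have [_ _] := Fgood _ _ FC CN; apply; exact: CN.
have {AP}[[A0 AP] J0A noA] : good A.
  case: AP => // A0; have := Amax J0; case; last by right.
  rewrite A0; split=> [x //|]; move=> /(_ 0); apply.
  by case: J0good => -[].
have AD u v : A u -> A v -> A (u + v) by move=> Au Av; rewrite -[u]mul1r; apply: AP.
have AM a u : A u -> A (a * u) by move=> Au; rewrite -[_ * _]addr0; apply: AP.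
have big w : ~ A w -> exists N u c, A u /\ 'X_i ^+ N = u + c * w.
  move=> Aw; apply: contrapT => noN'.
  apply: (Amax (fun x => exists u c, A u /\ x = u + c * w)).
    split=> [x Ax|]; first by exists x, 0; rewrite mul0r addr0.
    by move=> /(_ w) H; apply/Aw/H; exists 0, 1; rewrite mul1r add0r.
  right; split.
  - split; first by exists 0, 0; rewrite mul0r addr0.
    move=> a _ _ [u [c [Au ->]]] [u' [c' [Au' ->]]].
    exists (a * u + u'), (a * c + c'); split; first exact: AP.
    by rewrite mulrDr mulrDl mulrA addrACA.
  - by move=> x /J0A Ax; exists x, 0; rewrite mul0r addr0.
  - by move=> N [u [c uc]]; apply: noN'; exists N, u, c.
have Apr u v : A (u * v) -> A u \/ A v.
  move=> Auv; apply: contrapT => /not_orP [/big [N [a [c [Aa E]]]] /big [M [b [d [Ab E']]]]].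
  apply: (noA (N + M)%N); rewrite exprD E E' mulrDl.
  apply/AD; first by rewrite mulrC; apply: AM.
  rewrite mulrDr; apply/AD; first exact: AM.
  by rewrite mulrACA; apply: AM.
have [q qP] := homog_core_prime A0 AP (noA 0%N) Apr.
have homX j : ('X_j : P) \is 1.-homog by rewrite dhomogX /= mdeg1.
have qX j : ('X_j : P) \in q <-> A 'X_j.
  rewrite qP; split=> [/(_ 1%N)|AX d]; first by rewrite pihomog_dE.
  have [<-|ne] := eqVneq 1%N d; first by rewrite pihomog_dE.
  by rewrite (pihomog_ne0 ne).
have qsupp : in_support J q.
  split; last first.
    move=> f Jf; apply/qP => d; apply: J0A.
    by exists (pihomog mdeg d f), 0; rewrite mulr0 addr0 hJ.
  split; first by move=> f d /qP Af; apply/qP; apply: homog_core_homog.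
  by exists i; apply/negP => /qX; apply: (noA 1%N).
move/negP: (JX0 q qsupp); apply; apply/qX; apply: J0A.
by exists 0, 1; rewrite rpred0 mulr1 add0r.
Qed.

Lemma avoids_X0_regularity J : homog_ideal J -> avoids_X0 J ->
  exists d0, forall d, (d0 <= d)%N -> forall f : P, f \is d.+1.-homog ->
    exists u v, [/\ u \in J, v \is d.-homog & f = u + 'X_ord0 * v].
Proof.
move=> hJ JX0.
have /choice [N NP] : forall i, exists N, exists u v,
    u \in J /\ ('X_i : P) ^+ N = u + 'X_ord0 * v.
  by move=> i; apply: avoids_X0_power.
exists (\sum_i N i)%N => d dN f fd.
have [u [v [Ju E]]] : exists u v, u \in J /\ f = u + 'X_ord0 * v.
  pose Q f := exists u v, u \in J /\ f = u + 'X_ord0 * v.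
  rewrite -/(Q f) (mpolyE f) big_seq; apply: (big_ind Q) => [|? ?|m mf].
  - by exists 0, 0; rewrite rpred0 mulr0 addr0.
  - move=> [u [v [Ju ->]]] [u' [v' [Ju' ->]]].
    by exists (u + u'), (v + v'); rewrite rpredD // mulrDr addrACA.
  have md : mdeg m = d.+1 by exact: (dhomog_mf fd).
  have [i Ni] : exists i, (N i <= m i)%N.
    apply: contrapT => /forallNP noi.
    have : (d.+1 <= \sum_i N i)%N.
      by rewrite -md mdegE; apply: leq_sum => i _; move/negP: (noi i); lia.
    by lia.
  have [u [v [Ju E]]] := NP i.
  have -> : 'X_[m] = 'X_[m - U_(i) *+ N i] * ('X_i : P) ^+ N i.
    rewrite mpolyXn -mpolyXD submK //; apply/mnm_lepP => j.
    by rewrite mulmnE mnm1E; case: eqP => [<-|_]; rewrite ?mul1n.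
  exists (f@_m *: 'X_[m - U_(i) *+ N i] * u), (f@_m *: 'X_[m - U_(i) *+ N i] * v).
  by rewrite idealMr // E mulrDr scalerDr !scalerAl [in RHS]mulrCA.
exists (pihomog mdeg d.+1 u), (pihomog mdeg d v); rewrite hJ // pihomogP; split=> //.
have X0d : ('X_ord0 : P) \is 1.-homog by rewrite dhomogX /= mdeg1.
by rewrite -{1}(pihomog_dE fd) E pihomogD (pihomogMl _ _ X0d) /= subn1.
Qed.

Local Notation Pd := (dhomog n.+1 K).

Fact mulX0_homog d (f : Pd d) : 'X_ord0 * (f : P) \is d.+1.-homog.
Proof.
rewrite -[X in X.-homog]add1n; apply: dhomogM; last exact: dhomog_is_dhomog.
by rewrite dhomogX /= mdeg1.
Qed.

Definition mulX0 d (f : Pd d) : Pd d.+1 := DHomog (mulX0_homog f).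

Fact mulX0_linear d : linear (@mulX0 d).
Proof. by move=> a u v; apply/val_inj; rewrite /= mulrDr scalerAr. Qed.
HB.instance Definition _ d :=
  GRing.isLinear.Build K (Pd d) (Pd d.+1) *:%R (@mulX0 d) (@mulX0_linear d).

Lemma HF_scheme_decr J : homog_ideal J -> avoids_X0 J ->
  exists d0 : nat, forall d : nat, (d0 <= d)%N ->
    (HF_scheme J d.+1 <= HF_scheme J d)%N.
Proof.
move=> hJ /(avoids_X0_regularity hJ) [d0 d0P]; exists d0 => d /d0P dP.
pose G := linfun (@mulX0 d); pose V := homog_part J d.+1.
have kerG : lker G = 0%VS.
  apply/eqP/lker0P => f g; rewrite !lfunE => /(congr1 val) /= /mulfI H.
  apply/val_inj/H; apply/eqP => /(congr1 (mcoeff U_(ord0))).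
  by rewrite mcoeffXU eqxx mcoeff0 => /eqP; rewrite oner_eq0.
have full : (G @: fullv + V)%VS = fullv.
  apply/vspaceP => f; rewrite memvf.
  have [u [v [Ju vd E]]] := dP f (dhomog_is_dhomog f).
  rewrite addvC; apply/memv_addP.
  have uE : u = val (f - G (DHomog vd)) by rewrite /= lfunE /= E addrK.
  exists (f - G (DHomog vd)); first by apply/homog_partP; rewrite -[X in X \in J]uE.
  by exists (G (DHomog vd)); [apply: memv_img; apply: memvf|rewrite subrK].
have := dimv_sum_cap (G @: fullv) V; rewrite full.
rewrite [\dim (G @: _)]limg_dim_eq ?kerG ?capv0 //.
have : (\dim (homog_part J d) <= \dim (G @: fullv :&: V))%N.
  rewrite -(@limg_dim_eq _ _ _ G) ?kerG ?capv0 // dimvS // subv_cap limgS ?subvf //.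
  apply/subvP => _ /memv_imgP [f /homog_partP Jf ->]; apply/homog_partP.
  by rewrite lfunE /= idealMr.
have arith a b c v j : (j <= c -> a + c = b + v -> a - v <= b - j)%N by lia.
by rewrite !HF_schemeE; apply: arith.
Qed.

Lemma HF_scheme_eventually J : homog_ideal J -> avoids_X0 J ->
  exists c d0 : nat, forall d : nat, (d0 <= d)%N -> HF_scheme J d = c.
Proof.
move=> hJ /(HF_scheme_decr hJ) [d0 d0P].
pose Q c := `[< exists2 d : nat, (d0 <= d)%N & HF_scheme J d = c >].
have exQ : exists c, Q c by exists (HF_scheme J d0); apply/asboolP; exists d0.
case: (ex_minnP exQ) => c /asboolP [d1 d01 <-] cmin.
exists (HF_scheme J d1), d1 => d; elim: d => [|d IH].
  by rewrite leqn0 => /eqP ->.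
rewrite leq_eqVlt => /predU1P [<- //|]; rewrite ltnS => d1d.
have d0d : (d0 <= d)%N by exact: leq_trans d01 d1d.
apply/eqP; rewrite eqn_leq -{1}(IH d1d) d0P //= cmin //.
by apply/asboolP; exists d.+1 => //; apply: leqW.
Qed.

Lemma HF_scheme_gt0 J (d : nat) : avoids_X0 J -> (exists p, in_support J p) ->
  (0 < HF_scheme J d)%N.
Proof.
move=> JX0 [p ps]; rewrite HF_schemeE subn_gt0 ltnNge; apply/negP => le.
have X0d : ('X_ord0 : P) ^+ d \is d.-homog.
  by rewrite -{2}[d]mul1n; apply: dhomogMn; rewrite dhomogX /= mdeg1.
have : homog_part J d == fullv by rewrite eqEdim subvf.
move/eqP/vspaceP/(_ (DHomog X0d)); rewrite memvf => /homog_partP /= Jx.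
have pX0 : ('X_ord0 : P) ^+ d \in p by case: ps => _; apply.
move/negP: (JX0 p ps); apply.
elim: d pX0 {X0d le Jx} => [|d IH]; first by rewrite expr0 idealr1.
by rewrite exprS prime_idealrM => /orP [|/IH].
Qed.

Lemma diff_ideal_support J p : in_support (diff_ideal J) p <-> in_support J p.
Proof.
split=> -[pp Jp]; split=> // f Jf; last by have /diff_idealP [/Jp] := Jf.
by have := Jp _ (sqr_diff_ideal Jf); rewrite prime_idealrM orbb.
Qed.

Lemma diff_ideal_avoids J : avoids_X0 J -> avoids_X0 (diff_ideal J).
Proof. by move=> JX0 p /diff_ideal_support; apply: JX0. Qed.

End Support.

(** * Hilbert polynomials and regularity indices *)

Section HilbertPolynomial.
Implicit Types (hf : int -> nat) (c : rat) (q : {poly rat}).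

Definition eventually_eq hf c := exists d0 : nat, forall d : nat, (d0 <= d)%N -> (hf d)%:R = c.

Lemma is_HP_uniq hf q q' : is_HP hf q -> is_HP hf q' -> q = q'.
Proof.
move=> [i qi] [i' qi']; apply/eqP; rewrite -subr_eq0; apply/eqP.
pose j := Num.max i i'; pose s := [seq (j + k%:Z)%:~R : rat | k <- iota 0 (size (q - q'))].
apply: (@roots_geq_poly_eq0 _ _ s); last by rewrite size_map size_iota.
- apply/allP => _ /mapP [k _ ->]; rewrite rootE hornerD hornerN.
  by rewrite -qi -?qi' ?subrr //; apply: (@le_trans _ _ j);
    rewrite ?lerDl ?le_max ?lexx ?orbT.
- rewrite map_inj_uniq ?iota_uniq // => k k' /eqP.
  by rewrite eqr_int => /eqP /addrI [].
Qed.

Lemma eventually_HP hf c : eventually_eq hf c -> HP hf = c%:P.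
Proof.
move=> [d0 hc]; have hP : is_HP hf c%:P.
  by exists d0 => -[d|//] d0d; rewrite hornerC hc.
by apply: (is_HP_uniq _ hP); apply: (@xgetPex _ 0 [set q | is_HP hf q]%classic); exists c%:P.
Qed.

Lemma agrees_fromE hf c i : eventually_eq hf c ->
  agrees_from hf i <-> forall j, i <= j -> (hf j)%:R = c.
Proof.
by move=> /eventually_HP hP; split=> H j ij; have := H j ij; rewrite hP hornerC.
Qed.

Lemma ri_agrees hf c : eventually_eq hf c -> c != 0 -> (forall d, hf (Negz d) = 0%N) ->
  0 <= ri hf /\ agrees_from hf (ri hf).
Proof.
move=> hc c0 hneg.
have ge0 i : agrees_from hf i -> 0 <= i.
  rewrite (agrees_fromE _ hc); case: i => // d /(_ (Negz 0)) /=.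
  by rewrite hneg => H; move/eqP: c0; case; rewrite -H.
have ex : exists d : nat, `[< agrees_from hf d >].
  have [d0 d0P] := hc; exists d0; apply/asboolP/(agrees_fromE _ hc).
  by case=> [d|//] /d0P.
case: (ex_minnP ex) => d /asboolP ad dmin.
have : agrees_from hf (ri hf) /\ forall k, agrees_from hf k -> ri hf <= k.
  apply: (@xgetPex _ 0 [set i | agrees_from hf i /\ forall k, agrees_from hf k -> i <= k]%classic).
  exists d%:Z => /=; split; first exact: ad.
  move=> k ak; have k0 := ge0 _ ak; move: k0 ak; case: k => // k _ ak.
  by rewrite lez_nat dmin //; apply/asboolP.
by case=> ar _; split=> //; apply: ge0.
Qed.

(* If there is no minimum, [ri] is [0]. *)
Lemma ri_le hf i : 0 <= i -> agrees_from hf i -> ri hf <= i.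
Proof.
move=> i0 ai; rewrite /ri; case: xgetP => [k -> [_]|//]; exact.
Qed.

End HilbertPolynomial.

Section Asymptotics.
Variables (K : fieldType) (n : nat) (I : idealr {mpoly K[n.+1]}).
Hypotheses (hI : homog_ideal I) (IX0 : avoids_X0 I).

Lemma HF_scheme_deg : eventually_eq (HF_scheme I) (deg_scheme I).
Proof.
have [c [d0 cP]] := HF_scheme_eventually hI IX0.
have hc : eventually_eq (HF_scheme I) c%:R by exists d0 => d /cP ->.
by rewrite /deg_scheme (eventually_HP hc) coefC.
Qed.

End Asymptotics.

Section OmegaAsymptotics.
Variables (K : fieldType) (n : nat) (I : idealr {mpoly K[n.+1]}).
Hypotheses (hI : homog_ideal I) (IX0 : avoids_X0 I) (supp : exists p, in_support I p).
Local Notation J := (diff_ideal I).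

Lemma HF_Omega_rat (d : nat) : (HF_Omega I d.+1)%:R =
  n.+1%:R * (HF_scheme I d)%:R + (HF_scheme I d.+1)%:R - (HF_scheme J d.+1)%:R :> rat.
Proof.
have := HF_OmegaE d.+1 hI; have -> : d.+1%:Z - 1 = d%:Z by rewrite intS [1 + _]addrC addrK.
move/(congr1 (intmul (1 : rat))); rewrite rmorphB rmorphD rmorphM /=.
by rewrite -!pmulrn.
Qed.

Let c := n.+2%:R * deg_scheme I - deg_scheme J.

Let HF_J : eventually_eq (HF_scheme J) (deg_scheme J).
Proof. exact: HF_scheme_deg (diff_ideal_homog hI) (diff_ideal_avoids IX0). Qed.

Let arith (x y : rat) : n.+1%:R * x + x - y = n.+2%:R * x - y.
Proof. by rewrite -[n.+2]addn1 natrD mulrDl mul1r. Qed.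

Lemma HF_Omega_eventually : eventually_eq (HF_Omega I) c.
Proof.
have [d1 d1P] := HF_scheme_deg hI IX0; have [d2 d2P] := HF_J.
exists (maxn d1 d2).+1 => -[//|d]; rewrite ltnS geq_max => /andP [d1d d2d].
by rewrite HF_Omega_rat !d1P ?d2P ?arith // ltnW.
Qed.

Lemma HP_Omega : HP (HF_Omega I) = c%:P.
Proof. exact: eventually_HP HF_Omega_eventually. Qed.

Lemma ri_Omega : ri (HF_Omega I) <= Num.max (ri (HF_scheme I) + 1) (ri (HF_scheme J)).
Proof.
have degN0 (L : idealr {mpoly K[n.+1]}) :
    homog_ideal L -> avoids_X0 L -> (exists p, in_support L p) ->
    deg_scheme L != 0.
  move=> hL LX0 Ls; have [d0 d0P] := HF_scheme_deg hL LX0.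
  by rewrite -(d0P d0) // pnatr_eq0 -lt0n HF_scheme_gt0.
have suppJ : exists p, in_support J p by case: supp => p /diff_ideal_support; exists p.
have [rI aI] := ri_agrees (HF_scheme_deg hI IX0) (degN0 _ hI IX0 supp) (HF_scheme_neg I).
have [rJ aJ] := ri_agrees HF_J (degN0 _ (diff_ideal_homog hI) (diff_ideal_avoids IX0) suppJ)
  (HF_scheme_neg J).
move/(agrees_fromE _ (HF_scheme_deg hI IX0)): aI => aI.
move/(agrees_fromE _ HF_J): aJ => aJ.
apply: ri_le; first by rewrite le_max rJ orbT.
apply/(agrees_fromE _ HF_Omega_eventually) => j; rewrite ge_max => /andP [].
case: j => [[|d]|d]; try by move: rI; lia.
move=> Id Jd; have Id' : ri (HF_scheme I) <= d by move: Id; rewrite -addn1 PoszD lerD2r.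
by rewrite HF_Omega_rat !aI ?aJ ?arith // (le_trans Id') // lez_nat.
Qed.

End OmegaAsymptotics.

(** * Taylor expansions and interpolation *)

Section Vanishing.
Variables (K : fieldType) (n : nat).
Local Notation L := {mpoly K[n]}.
Implicit Types (g h : L) (b : 'X_{1..n}).

Definition vanishing (m : nat) g := forall b, (mdeg b < m)%N -> g@_b = 0.

Lemma vanishing0 m : vanishing m 0.
Proof. by move=> b _; rewrite mcoeff0. Qed.

Lemma vanishingD m g h : vanishing m g -> vanishing m h -> vanishing m (g + h).
Proof. by move=> gm hm b bm; rewrite mcoeffD gm // hm // addr0. Qed.

Lemma vanishingN m g : vanishing m g -> vanishing m (- g).
Proof. by move=> gm b bm; rewrite mcoeffN gm // oppr0. Qed.

Lemma vanishingM m k g h : vanishing m g -> vanishing k h -> vanishing (m + k) (g * h).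
Proof.
move=> gm hk b bmk; rewrite mcoeffM big1 // => -[u v] /= /eqP E.
have [um|mu] := ltnP (mdeg u) m; first by rewrite gm ?mul0r.
rewrite [h@__]hk ?mulr0 //.
by have := congr1 (@mdeg n) E; rewrite mdegD; lia.
Qed.

Lemma vanishingMr m g h : vanishing m h -> vanishing m (g * h).
Proof. by move=> hm; apply: (@vanishingM 0). Qed.

Lemma vanishing_sum m (T : Type) (r : seq T) (F : T -> L) :
  (forall i, vanishing m (F i)) -> vanishing m (\sum_(i <- r) F i).
Proof.
move=> Fm; apply: (big_ind (vanishing m)) => //; first exact: vanishing0.
exact: vanishingD.
Qed.

Lemma vanishingX b : vanishing (mdeg b) 'X_[b].
Proof.
by move=> c cb; rewrite mcoeffX; case: eqP => // bc; move: cb; rewrite bc ltnn.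
Qed.

Lemma vanishing1 g : vanishing 1 g <-> g@_0 = 0.
Proof.
split=> [|g0 b]; first by apply; rewrite mdeg0.
by rewrite ltnS leqn0 mdeg_eq0 => /eqP ->.
Qed.

Lemma mcoeffMX_low g b c : (mdeg c <= mdeg b)%N ->
  (g * 'X_[b])@_c = if c == b then g@_0 else 0.
Proof.
move=> cb; have g0 : vanishing 1 (g - (g@_0)%:MP).
  by apply/vanishing1; rewrite mcoeffB mcoeffC eqxx mulr1 subrr.
rewrite -[g in LHS](subrK (g@_0)%:MP) mulrDl mcoeffD mul_mpolyC mcoeffZ mcoeffX.
rewrite (vanishingM g0 (@vanishingX b)) // add0r [c == b]eq_sym.
by case: eqP => _; rewrite ?mulr1 ?mulr0.
Qed.

End Vanishing.

Section Germs.
Variables (K : fieldType) (n : nat).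
Local Notation P := {mpoly K[n.+1]}.
Local Notation L := {mpoly K[n]}.
Implicit Types (a : 'I_n -> K) (f g : P).

Lemma comp_homog k d f (lq : n.+1.-tuple {mpoly K[k]}) :
  (forall i, tnth lq i \is 1.-homog) -> f \is d.-homog -> f \mPo lq \is d.-homog.
Proof.
move=> lq1 fd; rewrite (mpolyE f) raddf_sum big_seq; apply: rpred_sum => m mf.
rewrite /= comp_mpolyZ rpredZ // comp_mpolyX -(dhomog_mf fd mf) /= mdegE.
pose Q (h : {mpoly K[k]}) d := h \is d.-homog.
apply: (big_ind2 Q) => [|h e h' e'|i _]; first exact: dhomog1.
  exact: dhomogM.
by rewrite /Q -[m i in X in _ \is X]mul1n; apply: dhomogMn.
Qed.

(* Taylor expansion in the chart ['X_0 = 1] at the point with affine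
   coordinates [a]. *)
Definition germ a : P -> L :=
  comp_mpoly [tuple if unlift ord0 i is Some k then (a k)%:MP + 'X_k else 1 | i < n.+1].
HB.instance Definition _ a := GRing.RMorphism.on (germ a).
HB.instance Definition _ a := GRing.Linear.on (germ a).

Lemma germX a i :
  germ a 'X_i = if unlift ord0 i is Some k then (a k)%:MP + 'X_k else 1.
Proof. by rewrite /germ /comp_mpoly mmapX mmap1U tnth_mktuple. Qed.

Lemma germX0 a : germ a 'X_ord0 = 1.
Proof. by rewrite germX unlift_none. Qed.

Lemma germXS a k : germ a 'X_(lift ord0 k) = (a k)%:MP + 'X_k.
Proof. by rewrite germX liftK. Qed.

Lemma germC a c : germ a c%:MP = c%:MP.
Proof. exact: comp_mpolyC. Qed.

Lemma germZ a c f : germ a (c *: f) = c *: germ a f.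
Proof. exact: comp_mpolyZ. Qed.

Lemma germ_sum a (T : Type) (r : seq T) (A : pred T) (F : T -> P) :
  germ a (\sum_(i <- r | A i) F i) = \sum_(i <- r | A i) germ a (F i).
Proof. exact: (raddf_sum (germ a)). Qed.

Lemma germ_deriv a k f : germ a f^`M(lift ord0 k) = (germ a f)^`M(k).
Proof.
pose E f : L^o := (germ a f)^`M(k).
have EE := derivation_mpolyE (pi := germ a) (E := E).
rewrite -[RHS]/(E f) EE /E => [|g h|g h|c].
- rewrite (bigD1 (lift ord0 k)) //= germXS mderivD mderivC mderivX add0r.
  rewrite mnm1E eqxx scale1r.
  have -> : (U_(k) - U_(k) = 0 :> 'X_{1..n})%MM.
    by apply/mnmP => i; rewrite mnmBE mnm0E subnn.
  rewrite mpolyX0 {1}/GRing.scale /= mulr1 big1 ?addr0 // => j jk.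
  rewrite germX; case: unliftP => [i ji|_]; last first.
    by rewrite -mpolyC1 mderivC scaler0.
  rewrite mderivD mderivC mderivX add0r mnm1E.
  have -> : (i == k) = false.
    by apply/negbTE; apply: contra jk => /eqP <-; rewrite ji.
  by rewrite scale0r scaler0.
- by rewrite rmorphD mderivD.
- by rewrite rmorphM mderivM /GRing.scale /= addrC [_^`M(k) * _]mulrC.
- by rewrite germC mderivC.
Qed.

(* Linear forms vanishing at the point; they become the affine coordinates. *)
Definition local_coord a k : P := 'X_(lift ord0 k) - (a k)%:MP * 'X_ord0.

Lemma homogXU i : ('X_i : P) \is 1.-homog.
Proof. by rewrite dhomogX /= mdeg1. Qed.

Lemma local_coord_homog a k : local_coord a k \is 1.-homog.
Proof. by rewrite rpredB ?homogXU // mul_mpolyC rpredZ // homogXU. Qed.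

Lemma germ_local_coord a a' k : germ a (local_coord a' k) = (a k - a' k)%:MP + 'X_k.
Proof. by rewrite rmorphB rmorphM /= germXS germX0 germC mulr1 mpolyCB addrAC. Qed.

Definition local_mon a (b : 'X_{1..n}) : P := \prod_k local_coord a k ^+ b k.

Lemma local_mon_homog a b : local_mon a b \is (mdeg b).-homog.
Proof.
pose Q (h : P) d := h \is d.-homog.
rewrite mdegE; apply: (big_ind2 Q) => [|h e h' e'|i _]; first exact: dhomog1.
  exact: dhomogM.
by rewrite /Q -[b i in X in _ \is X]mul1n; apply/dhomogMn/local_coord_homog.
Qed.

Lemma germ_local_mon a b : germ a (local_mon a b) = 'X_[b].
Proof.
rewrite rmorph_prod mpolyXE_id; apply: eq_bigr => k _.
by rewrite rmorphXn /= germ_local_coord subrr mpolyC0 add0r.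
Qed.

Definition mnm_tail (u : 'X_{1..n.+1}) : 'X_{1..n} := [multinom u (lift ord0 k) | k < n].

Lemma mdeg_tail u : mdeg u = (u ord0 + mdeg (mnm_tail u))%N.
Proof.
by rewrite !mdegE big_ord_recl; congr addn; apply: eq_bigr => k _; rewrite mnmE.
Qed.

Lemma mnm_tail_inj u v : mdeg u = mdeg v -> mnm_tail u = mnm_tail v -> u = v.
Proof.
move=> duv uv; apply/mnmP => i; case: (unliftP ord0 i) => [k ->|->].
  by move/mnmP: uv => /(_ k); rewrite !mnmE.
by move: duv; rewrite !mdeg_tail uv => /addIn.
Qed.

Lemma local_expansion a d f : f \is d.-homog ->
  exists r : seq 'X_{1..n.+1},
    f = \sum_(u <- r) (germ a f)@_(mnm_tail u) *: ('X_ord0 ^+ u ord0 * local_mon a (mnm_tail u)).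
Proof.
move=> fd.
pose psi : P -> P := comp_mpoly
  [tuple if unlift ord0 i is Some k then (a k)%:MP * 'X_ord0 + 'X_i else 'X_i | i < n.+1].
pose phi : P -> P := comp_mpoly
  [tuple if unlift ord0 i is Some k then local_coord a k else 'X_i | i < n.+1].
have psiX i : psi 'X_i = if unlift ord0 i is Some k then (a k)%:MP * 'X_ord0 + 'X_i else 'X_i.
  by rewrite /psi /comp_mpoly mmapX mmap1U tnth_mktuple.
have phiX i : phi 'X_i = if unlift ord0 i is Some k then local_coord a k else 'X_i.
  by rewrite /phi /comp_mpoly mmapX mmap1U tnth_mktuple.
have psid : psi f \is d.-homog.
  apply: comp_homog fd => i; rewrite tnth_mktuple; case: unliftP => [k|] _; rewrite ?homogXU //.
  by rewrite rpredD ?homogXU // mul_mpolyC rpredZ // homogXU.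
have phipsi g : phi (psi g) = g.
  elim/mpoly_alg_ind: g => [c|i|g h gP hP|g h gP hP].
  - by rewrite /phi /psi !comp_mpolyC.
  - rewrite psiX; case: unliftP => [k ->|->]; last by rewrite phiX unlift_none.
    rewrite /phi raddfD /= rmorphM /= comp_mpolyC -!/(phi _) !phiX unlift_none liftK.
    by rewrite addrC subrK.
  - by rewrite /phi /psi !raddfD /= -!/(psi _) -!/(phi _) gP hP.
  - by rewrite /phi /psi !rmorphM /= -!/(psi _) -!/(phi _) gP hP.
have germpsi g : germ (fun=> 0) (psi g) = germ a g.
  elim/mpoly_alg_ind: g => [c|i|g h gP hP|g h gP hP].
  - by rewrite /psi comp_mpolyC !germC.
  - rewrite psiX; case: unliftP => [k ->|->]; last by rewrite !germX0.
    by rewrite rmorphD rmorphM /= germC germX0 !germXS mpolyC0 add0r mulr1.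
  - by rewrite /psi !raddfD /= -!/(psi _) gP hP.
  - by rewrite /psi !rmorphM /= -!/(psi _) gP hP.
have germ0X u : germ (fun=> 0) 'X_[u] = 'X_[mnm_tail u].
  rewrite mpolyXE_id rmorph_prod big_ord_recl rmorphXn /= germX0 expr1n mul1r.
  rewrite mpolyXE_id; apply: eq_bigr => k _.
  by rewrite rmorphXn /= germXS mpolyC0 add0r mnmE.
have phiXm u : phi 'X_[u] = 'X_ord0 ^+ u ord0 * local_mon a (mnm_tail u).
  rewrite mpolyXE_id /phi rmorph_prod big_ord_recl /= rmorphXn /= -/(phi _) phiX unlift_none.
  congr (_ * _); apply: eq_bigr => k _.
  by rewrite rmorphXn /= -/(phi _) phiX liftK mnmE.
clearbody psi; exists (msupp (psi f)).
rewrite -[LHS]phipsi {1}(mpolyE (psi f)) /phi raddf_sum; apply: eq_big_seq => u uf /=.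
rewrite comp_mpolyZ -/(phi _) phiXm; congr (_ *: _).
have -> : germ a f = \sum_(v <- msupp (psi f)) (psi f)@_v *: 'X_[mnm_tail v].
  rewrite -germpsi {1}(mpolyE (psi f)) raddf_sum; apply: eq_bigr => v _.
  by rewrite [LHS]germZ germ0X.
rewrite raddf_sum (bigD1_seq u) ?msupp_uniq //= mcoeffZ mcoeffX eqxx mulr1.
rewrite big_seq_cond big1 ?addr0 // => v /andP [vf vu].
rewrite mcoeffZ mcoeffX; case: eqP => [tvu|]; last by rewrite mulr0.
by move/eqP: vu; case; apply: mnm_tail_inj; rewrite // !(dhomog_mf psid).
Qed.

End Germs.

Section Interpolation.
Variables (K : fieldType) (n s M : nat) (a : 'I_s -> 'I_n -> K).
Hypothesis a_inj : forall j k, a j =1 a k -> j = k.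
Local Notation P := {mpoly K[n.+1]}.

Lemma separating_form j : exists h : P,
  [/\ h \is (s * M.+1).-homog, (germ (a j) h)@_0 = 1 &
      forall k, k != j -> vanishing M.+1 (germ (a k) h)].
Proof.
have /choice [l lP] : forall k, exists l : P,
    [/\ l \is 1.-homog, (germ (a j) l)@_0 != 0 & k != j -> vanishing 1 (germ (a k) l)].
  move=> k; have [->|kj] := eqVneq k j.
    by exists 'X_ord0; rewrite homogXU germX0 mcoeff1 eqxx oner_eq0.
  have [i ai] : exists i, a j i != a k i.
    apply: contrapT => /forallNP aE; move/eqP: kj; apply; apply: a_inj => i.
    by apply/eqP; rewrite eq_sym; apply: contrapT => /negP; apply: aE.
  exists (local_coord (a k) i); split; first exact: local_coord_homog.
    rewrite germ_local_coord mcoeffD mcoeffC mcoeffX eqxx mulr1 mnm1_eq0 addr0.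
    by rewrite subr_eq0.
  move=> _; apply/vanishing1; rewrite germ_local_coord subrr mpolyC0 add0r.
  by rewrite mcoeffX mnm1_eq0.
pose h := \prod_k l k ^+ M.+1.
have hs : h \is (s * M.+1).-homog.
  pose Q (g : P) d := g \is d.-homog.
  rewrite -[s in X in _ \is X]card_ord -sum_nat_const.
  apply: (big_ind2 Q) => [|g e g' e'|k _]; first exact: dhomog1.
    exact: dhomogM.
  by rewrite /Q -[M.+1 in X in _ \is X]mul1n; apply: dhomogMn; case: (lP k).
have h0 : (germ (a j) h)@_0 != 0.
  rewrite rmorph_prod rmorph_prod /=; apply/prodf_neq0 => k _.
  by rewrite !rmorphXn /= expf_neq0 //; case: (lP k).
exists (((germ (a j) h)@_0)^-1 *: h); split; first exact: rpredZ.
  by rewrite germZ mcoeffZ mulVf.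
move=> k kj; rewrite germZ -mul_mpolyC; apply: vanishingMr.
rewrite /h (bigD1 k) //= rmorphM mulrC; apply: vanishingMr; rewrite rmorphXn /=.
have l1 : vanishing 1 (germ (a k) (l k)) by case: (lP k) => _ _; apply.
elim: (M) => [|e IH]; first by rewrite expr1.
by rewrite exprS -add1n; apply: vanishingM.
Qed.

Lemma interpolation d : (s * M.+1 + M <= d)%N ->
  forall c : 'I_s -> 'X_{1..n} -> K, exists2 f : P, f \is d.-homog &
    forall j b, (mdeg b <= M)%N -> (germ (a j) f)@_b = c j b.
Proof.
move=> dM c; have /choice [h hP] := separating_form.
pose B j b := 'X_ord0 ^+ (d - (s * M.+1 + mdeg b)) * (h j * local_mon (a j) b).
have Bd j b : (mdeg b <= M)%N -> B j b \is d.-homog.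
  move=> bM; have [hs _ _] := hP j.
  rewrite -[X in _ \is X.-homog](_ :
    1 * (d - (s * M.+1 + mdeg b)) + (s * M.+1 + mdeg b) = d)%N; last by lia.
  apply: dhomogM; first exact/dhomogMn/homogXU.
  by apply: dhomogM => //; apply: local_mon_homog.
have BP j b k b' : (mdeg b <= M)%N -> (mdeg b' <= mdeg b)%N ->
    (germ (a k) (B j b))@_b' = ((k == j) && (b' == b))%:R.
  move=> bM b'b; have [_ h0 hk] := hP j; rewrite !rmorphM rmorphXn /= germX0 expr1n mul1r.
  have [->|kj] := eqVneq k j.
    by rewrite germ_local_mon mcoeffMX_low // h0; case: eqP.
  by rewrite mulrC (vanishingMr _ (hk _ kj)) // ltnS; apply: leq_trans b'b bM.
suff H e : (e <= M.+1)%N -> exists2 f : P, f \is d.-homog &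
    forall j b, (mdeg b < e)%N -> (germ (a j) f)@_b = c j b by exact: (H M.+1 (leqnn _)).
elim: e => [_|e IH eM]; first by exists 0; rewrite ?rpred0.
have [f0 f0d f0P] := IH (ltnW eM).
pose lam j b := c j b - (germ (a j) f0)@_b.
pose f1 := \sum_j \sum_(b : 'X_{1..n < e.+1} | mdeg b == e) lam j b *: B j b.
exists (f0 + f1).
  rewrite rpredD // rpred_sum // => j _; rewrite rpred_sum // => b /eqP be.
  by rewrite rpredZ // Bd // be.
move=> k b' b'e; rewrite raddfD mcoeffD.
have -> : (germ (a k) f1)@_b' = \sum_j
    \sum_(b : 'X_{1..n < e.+1} | mdeg b == e) (germ (a k) (lam j b *: B j b))@_b'.
  by rewrite germ_sum raddf_sum; apply: eq_bigr => j _; rewrite germ_sum raddf_sum.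
have E j : \sum_(b : 'X_{1..n < e.+1} | mdeg b == e) (germ (a k) (lam j b *: B j b))@_b' =
    if (k == j) && (mdeg b' == e) then lam j b' else 0.
  transitivity (\sum_(b : 'X_{1..n < e.+1} | mdeg b == e)
      lam j b * ((k == j) && (b' == b))%:R).
    by apply: eq_bigr => b /eqP be; rewrite germZ mcoeffZ /= BP // be.
  case: eqP => _ /=; last by rewrite big1 // => b _; rewrite mulr0.
  have [b'E|b'E] := eqVneq (mdeg b') e; last first.
    rewrite big1 // => b /eqP be; case: eqP => [bb|]; rewrite ?mulr0 //.
    by move: b'E; rewrite bb be eqxx.
  rewrite (bigD1 (BMultinom b'e)) /= ?b'E // eqxx mulr1 big1 ?addr0 // => b /andP [_ bb].
  case: eqP => [E|]; rewrite ?mulr0 //; move/eqP: bb; case; exact: val_inj.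
rewrite (eq_bigr _ (fun j _ => E j)) (bigD1 k) //= eqxx big1 ?addr0 => [|j].
  2: by rewrite eq_sym => /negbTE ->.
have [b'E|b'E] := eqVneq (mdeg b') e; first by rewrite addrC subrK.
by rewrite addr0 f0P // ltn_neqAle b'E.
Qed.

End Interpolation.

(** * Fat point ideals *)

Section FatPoints.
Variables (K : fieldType) (n : nat).
Local Notation P := {mpoly K[n.+1]}.
Implicit Types (x : 'I_n.+1 -> K) (f g : P).

Lemma meval_homog_scale d c x f : f \is d.-homog ->
  f.@[fun i => c * x i] = c ^+ d * f.@[x].
Proof.
move=> fd; rewrite !mevalE mulr_sumr; apply: eq_big_seq => u uf.
rewrite mulrCA; congr (_ * _).
under eq_bigr do rewrite exprMn.
by rewrite big_split /= -expr_sum -mdegE (dhomog_mf fd).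
Qed.

Lemma point_ideal_prime x : exists q : prime_idealr P,
  homog_ideal q /\ forall f, f \in q <-> point_ideal x f.
Proof.
have [|||u v|q qP] := @homog_core_prime K n.+1 (fun f => f.@[x] = 0).
- exact: meval0.
- by move=> b u v u0 v0; rewrite mevalD mevalM u0 v0 mulr0 addr0.
- by rewrite meval1; apply/eqP/oner_neq0.
- by rewrite mevalM => /eqP; rewrite mulf_eq0 => /orP [] /eqP; [left|right].
exists q; split=> // f d /qP fq; apply/qP.
by apply: (homog_core_homog (A := fun f => f.@[x] = 0)) => //; apply: meval0.
Qed.

Lemma point_ideal_homog x d f : f \is d.-homog -> f.@[x] = 0 -> point_ideal x f.
Proof.
move=> fd f0 e; have [<-|de] := eqVneq d e; first by rewrite pihomog_dE.
by rewrite (pihomog_ne0 de) ?meval0.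
Qed.

Section Power.
Variable J : P -> Prop.

Definition factors (m : nat) f := exists h (r : seq P),
  [/\ size r = m, forall g, g \in r -> J g & f = h * \prod_(g <- r) g].

Lemma factorsM k m f g : factors k f -> factors m g -> factors (k + m) (f * g).
Proof.
move=> [h [r [rk rJ ->]]] [h' [r' [rm rJ' ->]]]; exists (h * h'), (r ++ r').
split; first by rewrite size_cat rk rm.
  by move=> u; rewrite mem_cat => /orP [/rJ|/rJ'].
by rewrite big_cat mulrACA.
Qed.

Lemma factors0 f : factors 0 f.
Proof. by exists f, [::]; rewrite big_nil mulr1. Qed.

Lemma factors_leq m k f : (m <= k)%N -> factors k f -> factors m f.
Proof.
move=> mk [h [r [rk rJ ->]]]; exists (h * \prod_(g <- drop m r) g), (take m r).
split; first by rewrite size_takel // rk.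
  by move=> g /mem_take /rJ.
by rewrite -{1}(cat_take_drop m r) big_cat /= mulrA mulrAC.
Qed.

Lemma factorsX k f : J f -> factors k (f ^+ k).
Proof.
move=> Jf; exists 1, (nseq k f); rewrite size_nseq big_nseq mul1r.
by split=> // [g|]; [rewrite mem_nseq => /andP [_ /eqP ->]|rewrite iter_mulr mulr1].
Qed.

Lemma ideal_power_sum m (T : Type) (r : seq T) (F : T -> P) :
  (forall t, factors m (F t)) -> ideal_power J m (\sum_(t <- r) F t).
Proof.
move=> Fm.
have /choice [h /choice [u huP]] : forall k : 'I_(size r), exists h (u : seq P),
    [/\ size u = m, forall g, g \in u -> J g &
        F (tnth (in_tuple r) k) = h * \prod_(g <- u) g] by move=> k; apply: Fm.
exists (size r), h, (fun k j => nth 0 (u k) j); split=> [k j|].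
  by have [um uJ _] := huP k; apply/uJ/mem_nth; rewrite um.
rewrite big_tnth; apply: eq_bigr => k _; have [um _ ->] := huP k.
by rewrite (big_nth 0) um big_mkord.
Qed.

Lemma vanishing_ideal_power (a : 'I_n -> K) m f :
  (forall g, J g -> vanishing 1 (germ a g)) ->
  ideal_power J m f -> vanishing m (germ a f).
Proof.
move=> Ja [N [h [g [gJ ->]]]]; rewrite germ_sum; apply: vanishing_sum => k.
rewrite rmorphM rmorph_prod; apply: vanishingMr.
rewrite -[m in vanishing m]card_ord -sum1_card.
apply: (big_ind2 (fun h e => vanishing e h)) => [|u e v e'|j _].
- by move=> b.
- exact: vanishingM.
- exact/Ja/gJ.
Qed.

End Power.

Section Point.
Variable x : 'I_n.+1 -> K.
Hypothesis x0 : x ord0 != 0.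
Let a k := x (lift ord0 k) / x ord0.

Lemma germ_coef0 g : (germ a g)@_0 = g.@[fun i => (x ord0)^-1 * x i].
Proof.
elim/mpoly_alg_ind: g => [c|i|g h gP hP|g h gP hP].
- by rewrite germC mcoeffC eqxx mulr1 mevalC.
- rewrite germX mevalXU; case: unliftP => [k ->|->].
    by rewrite mcoeffD mcoeffC eqxx mulr1 mcoeffX mnm1_eq0 addr0 /a mulrC.
  by rewrite mcoeff1 eqxx mulVf.
- by rewrite rmorphD mcoeffD gP hP mevalD.
- by rewrite !rmorphM /= gP hP.
Qed.

Lemma point_ideal_vanishing g : point_ideal x g -> vanishing 1 (germ a g).
Proof.
move=> gx; apply/vanishing1; rewrite germ_coef0 (pihomog_partitionE (leqnn (msize g))).
rewrite raddf_sum big1 //= => d _.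
by rewrite (meval_homog_scale _ _ (pihomogP _ _ _)) gx mulr0.
Qed.

Lemma local_coord_point k : point_ideal x (local_coord a k).
Proof.
apply: point_ideal_homog (local_coord_homog a k) _.
by rewrite mevalB mevalM mevalC !mevalXU /a divfK ?subrr.
Qed.

Lemma ideal_power_pointP d m f : f \is d.-homog ->
  ideal_power (point_ideal x) m f <-> vanishing m (germ a f).
Proof.
move=> fd; split=> [|fm].
  exact: vanishing_ideal_power point_ideal_vanishing.
have [r E] := local_expansion a fd; rewrite {1}E; apply: ideal_power_sum => u.
have [um|mu] := ltnP (mdeg (mnm_tail u)) m.
  rewrite fm // scale0r; exists 0, (nseq m 0); rewrite size_nseq mul0r; split=> // g.
  by rewrite mem_nseq => /andP [_ /eqP ->] d'; rewrite raddf0 meval0.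
apply: factors_leq mu _; rewrite -mul_mpolyC mulrA.
rewrite -[mdeg _]add0n; apply: factorsM (factors0 _ _) _; rewrite mdegE.
apply: (big_ind2 (fun h e => factors (point_ideal x) e h)) => [|u1 e u2 e'|k _].
- exact: factors0.
- exact: factorsM.
- exact/factorsX/local_coord_point.
Qed.

End Point.
End FatPoints.

Section FatIdeal.
Variables (K : fieldType) (n s : nat) (I : idealr {mpoly K[n.+1]}).
Variables (x : 'I_s -> 'I_n.+1 -> K) (m : 'I_s -> nat).
Hypotheses (IX0 : avoids_X0 I) (hI : homog_ideal I).
Hypotheses (xP : distinct_points x) (m1 : forall j, (1 <= m j)%N).
Hypothesis IP : forall f, f \in I <-> fat_point_ideal x m f.
Local Notation P := {mpoly K[n.+1]}.
Let a j k := x j (lift ord0 k) / x j ord0.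

Lemma fat_x0 j : x j ord0 != 0.
Proof.
have [q [hq qP]] := point_ideal_prime (x j).
have qX i : ('X_i : P) \in q <-> x j i = 0.
  rewrite qP; split=> [/(_ 1%N)|xi0]; first by rewrite pihomog_dE ?homogXU // mevalXU.
  by apply: point_ideal_homog (homogXU K i) _; rewrite mevalXU.
have qI : in_support I q.
  split; first split=> //.
    have [/(_ j) [i xi] _] := xP.
    by exists i; apply/negP => /qX /eqP; apply/negP.
  move=> f /IP /(_ j) [N [h [g [gJ ->]]]]; rewrite rpred_sum // => k _.
  rewrite idealMr // (bigD1 (Ordinal (m1 j))) //= mulrC idealMr //.
  exact/qP/gJ.
by apply/eqP => /qX; apply/negP/(IX0 qI).
Qed.

Lemma fat_affine_inj j k : a j =1 a k -> j = k.
Proof.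
move=> ajk; have [_ inj] := xP; apply: inj.
exists (x j ord0 / x k ord0) => [|i]; first by rewrite mulf_neq0 ?invr_eq0 ?fat_x0.
case: (unliftP ord0 i) => [l ->|->]; last by rewrite divfK ?fat_x0.
have := ajk l; rewrite /a => /(canRL (divfK (fat_x0 j))) ->.
by rewrite mulrC mulrAC mulrA.
Qed.

Lemma fat_idealP d f : f \is d.-homog ->
  f \in I <-> forall j, vanishing (m j) (germ (a j) f).
Proof.
move=> fd; rewrite IP; split=> H j; first exact/(ideal_power_pointP (fat_x0 j) _ fd)/H.
exact/(ideal_power_pointP (fat_x0 j) _ fd)/H.
Qed.

(* By Euler's formula the partial derivative in ['X_0] imposes no condition of
   its own. *)
Lemma fat_diff_idealP d f : f \is d.-homog ->
  f \in diff_ideal I <-> forall j b, (mdeg b <= m j)%N ->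
    (mdeg b = m j -> exists k, (b k)%:R != 0 :> K) -> (germ (a j) f)@_b = 0.
Proof.
move=> fd.
have dfd i : f^`M(i) \is d.-1.-homog.
  by case: d fd => [|d] fd; [rewrite mderiv_homog0 // rpred0|apply: mderiv_homogS].
split=> [/diff_idealP [/(fat_idealP fd) If dIf] j b|H].
  rewrite leq_eqVlt => /predU1P [bm|bm _]; last exact: If.
  move=> /(_ bm) [k bk]; have bk0 : b k != 0%N by apply: contraNneq bk => ->.
  have bE : (b - U_(k) + U_(k))%MM = b by rewrite submK // lep1mP.
  have bkE : ((b - U_(k))%MM k).+1 = b k.
    by rewrite mnmBE mnm1E eqxx subn1 prednK // lt0n.
  have /fat_idealP - /(_ _ (dfd _) j (b - U_(k))%MM) := dIf (lift ord0 k).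
  have bdeg : (mdeg (b - U_(k))%MM < m j)%N by rewrite -bm -{2}bE mdegD mdeg1 addn1.
  rewrite germ_deriv mcoeff_mderiv bE bkE => /(_ bdeg) /eqP.
  by rewrite -mulr_natl mulf_eq0 (negbTE bk) => /eqP.
have If : f \in I.
  by apply/(fat_idealP fd) => j b bm; apply: H => [|E]; [exact: ltnW|rewrite E ltnn in bm].
have dS k : forall j, vanishing (m j) (germ (a j) f^`M(lift ord0 k)).
  move=> j b bm; rewrite germ_deriv mcoeff_mderiv -mulr_natl.
  have [->|bk] := eqVneq ((b k).+1%:R : K) 0; first by rewrite mul0r.
  rewrite H ?mulr0 // ?mdegD ?mdeg1 ?addn1 // => _; exists k.
  by rewrite mnmDE mnm1E eqxx addn1.
apply/diff_idealP; split=> // i; apply/(fat_idealP (dfd i)) => j.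
case: (unliftP ord0 i) => [k ->|->]; first exact: dS.
have -> : germ (a j) f^`M(ord0) = d%:R * germ (a j) f -
    \sum_k germ (a j) 'X_(lift ord0 k) * germ (a j) f^`M(lift ord0 k).
  have /(congr1 (germ (a j))) := homog_euler fd.
  rewrite germ_sum big_ord_recl !rmorphM /= germX0 mul1r rmorph_nat => <-.
  by under [X in _ - X]eq_bigr do rewrite -rmorphM; rewrite addrK.
apply: vanishingD; first by apply/vanishingMr/(proj1 (fat_idealP fd) If).
by apply: vanishingN; apply: vanishing_sum => k; apply/vanishingMr/dS.
Qed.

(* [M] bounds the order of the Taylor coefficients that occur in the
   conditions defining [J]. *)
Lemma deg_scheme_count (J : idealr P) M (A : 'I_s -> pred 'X_{1..n}) :
  homog_ideal J -> avoids_X0 J ->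
  (forall d f, f \is d.-homog ->
    f \in J <-> forall j b, (mdeg b <= M)%N -> A j b -> (germ (a j) f)@_b = 0) ->
  deg_scheme J = (\sum_j #|[pred b : 'X_{1..n < M.+1} | A j b]|)%:R.
Proof.
move=> hJ JX0 JP; have [d0 d0P] := HF_scheme_deg hJ JX0.
pose d := maxn d0 (s * M.+1 + M).
rewrite -(d0P d (leq_maxl _ _)) HF_schemeE; congr (_%:R).
pose T := {t : 'I_s * 'X_{1..n < M.+1} | A t.1 t.2}.
pose ev (f : dhomog n.+1 K d) : {ffun T -> K^o} :=
  [ffun t : T => (germ (a (val t).1) f)@_((val t).2)].
have ev_lin : linear ev.
  move=> c f g; apply/ffunP => t.
  by rewrite !ffunE [X in germ _ X]linearP rmorphD /= germZ mcoeffD mcoeffZ.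
pose E : {linear dhomog n.+1 K d -> {ffun T -> K^o}} :=
  HB.pack ev (GRing.isLinear.Build K _ _ *:%R ev ev_lin).
have kerE : lker (linfun E) = homog_part J d.
  apply/vspaceP => f; rewrite memv_ker lfunE; apply/eqP/homog_partP => [/ffunP f0|Jf].
    apply/(JP d _ (dhomog_is_dhomog f)) => j b bM Ab.
    have bM' : (mdeg b < M.+1)%N by [].
    by have := f0 (exist _ (j, BMultinom bM') Ab); rewrite !ffunE.
  apply/ffunP => -[[j b] /= Ab]; rewrite !ffunE /=.
  by apply: (proj1 (JP d _ (dhomog_is_dhomog f)) Jf) => //; rewrite -ltnS bmdeg.
have imgE : limg (linfun E) = fullv.
  apply/vspaceP => w; rewrite memvf.
  pose c j (b : 'X_{1..n}) : K :=
    if insub b is Some b' then if insub (j, b') is Some t then w t else 0 else 0.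
  have [f fd fP] := interpolation fat_affine_inj (leq_maxr d0 (s * M.+1 + M)) c.
  apply/memv_imgP; exists (DHomog fd); first exact: memvf.
  rewrite lfunE; apply/ffunP => -[[j b] /= Ab]; rewrite ffunE /= fP; last by rewrite -ltnS bmdeg.
  rewrite /c valK; case: insubP => [t _ tE|]; last by rewrite Ab.
  by congr (w _); apply: val_inj; rewrite tE.
have := limg_ker_dim (linfun E) fullv; rewrite capfv kerE imgE => <-; rewrite addKn.
rewrite dimvf -[LHS]/(#|{: T}| * 1)%N muln1 card_sig -sum1_card.
rewrite -(pair_big_dep xpredT (fun j (b : 'X_{1..n < M.+1}) => A j b) (fun _ _ => 1%N)) /=.
by apply: eq_bigr => j _; rewrite sum1_card.
Qed.

End FatIdeal.

(** * Counting monomials *)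

Section MonomialCounts.

Lemma card_bmnm_seq n M (A : pred 'X_{1..n}) (r : seq 'X_{1..n}) :
  uniq r -> (forall b, A b = (b \in r)) -> (forall b, A b -> (mdeg b < M)%N) ->
  #|[pred b : 'X_{1..n < M} | A b]| = size r.
Proof.
move=> ur Ar AM; rewrite cardE -(size_map val); apply/perm_size/uniq_perm => //.
  by rewrite map_inj_uniq ?enum_uniq //; apply: val_inj.
move=> b; rewrite -Ar; apply/mapP/idP => [[b' + ->]|Ab].
  by rewrite mem_enum.
by exists (BMultinom (AM _ Ab)) => //; rewrite mem_enum.
Qed.

Lemma card_bmnm_bij n n' M M' (A : pred 'X_{1..n}) (B : pred 'X_{1..n'})
    (F : 'X_{1..n} -> 'X_{1..n'}) (G : 'X_{1..n'} -> 'X_{1..n}) :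
  (forall b, A b -> (mdeg b < M)%N) -> (forall b, B b -> (mdeg b < M')%N) ->
  (forall b, A b -> B (F b)) -> (forall b, B b -> A (G b)) ->
  (forall b, A b -> G (F b) = b) -> (forall b, B b -> F (G b) = b) ->
  #|[pred b : 'X_{1..n < M} | A b]| = #|[pred b : 'X_{1..n' < M'} | B b]|.
Proof.
move=> AM BM AB BA FK GK.
pose r := [seq F (val b) | b <- enum [pred b : 'X_{1..n < M} | A b]].
rewrite (@card_bmnm_seq _ _ B r) ?size_map -?cardE // => [|b].
  rewrite map_inj_in_uniq ?enum_uniq // => b b'; rewrite !mem_enum !inE => Ab Ab'.
  by move/(congr1 G); rewrite !FK // => /val_inj.
apply/idP/mapP => [Bb|[b' + ->]]; last by rewrite mem_enum inE => /AB.
by exists (BMultinom (AM _ (BA _ Bb))); rewrite ?mem_enum ?inE ?GK //; apply: BA.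
Qed.

Lemma card_mdeg_lt n d M : (d < M)%N ->
  #|[pred b : 'X_{1..n < M} | (mdeg b < d.+1)%N]| = 'C(d + n, n).
Proof.
move=> dM.
pose F (b : 'X_{1..n}) : 'X_{1..n.+1} :=
  [multinom if unlift ord0 i is Some k then b k else (d - mdeg b)%N | i < n.+1].
have FK b : mnm_tail (F b) = b by apply/mnmP => k; rewrite !mnmE liftK.
have degF b : (mdeg b < d.+1)%N -> mdeg (F b) = d.
  by rewrite ltnS => bd; rewrite mdeg_tail FK mnmE unlift_none subnK.
have tail_le (b : 'X_{1..n.+1}) : (mdeg (mnm_tail b) <= mdeg b)%N.
  by rewrite (mdeg_tail b) leq_addl.
rewrite (@card_bmnm_bij _ n.+1 _ d.+1 (fun b => mdeg b < d.+1)%N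
  (fun b => mdeg b == d) F (@mnm_tail n)) //.
- rewrite (@card_bmnm_seq n.+1 d.+1 (fun b => mdeg b == d) _ (uniq_basis n.+1 d)) ?size_basis;
    first last.
  + by move=> b /eqP ->.
  + by move=> b; apply: basis_cover.
  by rewrite -bin_sub ?leq_addr // addKn.
- by move=> b bd; apply: leq_trans dM.
- by move=> b /eqP ->.
- by move=> b /degF ->.
- by move=> b /eqP bd; rewrite ltnS -bd tail_le.
- move=> b /eqP bd; apply: mnm_tail_inj; last exact: FK.
  by rewrite degF // ltnS -bd tail_le.
Qed.

Lemma card_mdeg_dvd n p d M : (0 < d)%N -> (d < M)%N ->
  #|[pred b : 'X_{1..n < M} | (mdeg b == d) && [forall k, (p %| b k)%N]]| =
  if (p %| d)%N then #|[pred b : 'X_{1..n < (d %/ p).+1} | mdeg b == (d %/ p)%N]| else 0%N.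
Proof.
move=> d0 dM; case: ifPn => [pd|npd]; last first.
  apply: eq_card0 => b; rewrite !inE; apply/negP => /andP [/eqP bd /forallP pb].
  by move/negP: npd; apply; rewrite -bd mdegE; apply: dvdn_sum.
have p0 : (0 < p)%N by apply: dvdn_gt0 pd.
rewrite -(@card_bmnm_bij n n (d %/ p).+1 M (fun b => mdeg b == (d %/ p)%N)
  (fun b => (mdeg b == d) && [forall k, (p %| b k)%N]) (fun b => b *+ p)%MM
  (fun b => [multinom (b k %/ p)%N | k < n])) //.
- by move=> b /eqP ->.
- by move=> b /andP [/eqP -> _].
- move=> b /eqP bd; rewrite mdegMn bd divnK // eqxx /=.
  by apply/forallP => k; rewrite mulmnE dvdn_mull.
- move=> b /andP [/eqP bd /forallP pb]; rewrite -(eqn_pmul2r p0) divnK // -bd !mdegE.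
  by rewrite big_distrl /=; apply/eqP/eq_bigr => k _; rewrite mnmE divnK.
- by move=> b _; apply/mnmP => k; rewrite mnmE mulmnE mulnK.
- by move=> b /andP [_ /forallP pb]; apply/mnmP => k; rewrite mulmnE mnmE divnK.
Qed.

Lemma characteristic_dvd (K : fieldType) p k :
  characteristic K p -> (k%:R == 0 :> K) = (p %| k)%N.
Proof.
move=> [pK|[-> K0]]; first by rewrite (dvdn_pcharf pK).
by rewrite dvd0n; move/pcharf0P: K0 => ->.
Qed.

Lemma bin_term_ge n m : (1 <= n)%N -> (1 <= m)%N ->
  ('C(m + n, n) + (if m == 1 then 1 else 2) <= n.+2 * 'C(m + n - 1, n) )%N.
Proof.
move=> n1 m1; set C := 'C(m + n - 1, n).
have E : (m * 'C(m + n, n) = (m + n) * C)%N.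
  have := mul_bin_down (m + n) n; rewrite addnK => <-.
  by rewrite -subn1.
case: eqVneq => [mE|mE].
  by move: E; rewrite /C mE add1n subn1 /= binn; lia.
have C2 : (2 <= C)%N.
  have -> : C = 'C(n + (m - 1), n) by congr 'C(_, _); lia.
  apply: (@leq_trans 'C(n.+1, n)); first by rewrite binSn; lia.
  by apply: leq_bin2l; lia.
rewrite -(leq_pmul2l m1) mulnDr E; nia.
Qed.

End MonomialCounts.

Section FatDegrees.
Variables (K : fieldType) (n s : nat) (I : idealr {mpoly K[n.+1]}).
Variables (x : 'I_s -> 'I_n.+1 -> K) (m : 'I_s -> nat) (p : nat).
Hypotheses (IX0 : avoids_X0 I) (hI : homog_ideal I).
Hypotheses (xP : distinct_points x) (m1 : forall j, (1 <= m j)%N).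
Hypothesis IP : forall f, f \in I <-> fat_point_ideal x m f.
Hypothesis Kp : characteristic K p.
Let M := (\max_j m j)%N.
Let mM j : (m j <= M)%N. Proof. exact: leq_bigmax. Qed.

Lemma deg_fat : deg_scheme I = (\sum_j 'C(m j + n - 1, n))%:R.
Proof.
rewrite (deg_scheme_count IX0 xP m1 IP (M := M) (A := fun j b => (mdeg b < m j)%N)) //.
  congr (_%:R); apply: eq_bigr => j _; case: (m j) (m1 j) (mM j) => // d _ dM.
  by rewrite card_mdeg_lt ?addSn ?subn1 //; apply: leqW.
move=> d f fd; rewrite (fat_idealP IX0 xP m1 IP fd); split=> H j b; last first.
  by move=> bm; apply: H => //; apply: leq_trans (mM j); apply: ltnW.
by move=> _; apply: H.
Qed.

Definition divisible_count j :=
  (if p %| m j then #|[pred b : 'X_{1..n < (m j %/ p).+1} | mdeg b == (m j %/ p)%N]| else 0)%N.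

Lemma deg_diff_fat :
  deg_scheme (diff_ideal I) + (\sum_j divisible_count j)%:R = (\sum_j 'C(m j + n, n))%:R.
Proof.
pose A j (b : 'X_{1..n}) :=
  (mdeg b <= m j)%N && ((mdeg b == m j) ==> [exists k, (b k)%:R != 0 :> K]).
rewrite (deg_scheme_count IX0 xP m1 IP (M := M) (A := A)); first last.
- move=> d f fd; rewrite (fat_diff_idealP IX0 xP m1 IP fd).
  split=> H j b; last first.
    move=> bm bex; apply: H; first exact: leq_trans bm (mM j).
    by rewrite /A bm; apply/implyP => /eqP /bex [k bk]; apply/existsP; exists k.
  move=> _ /andP [bm /implyP bex]; apply: H => // /eqP /bex /existsP [k bk].
  by exists k.
- exact: diff_ideal_avoids.
- exact: diff_ideal_homog.
rewrite -natrD -big_split; congr (_%:R); apply: eq_bigr => j _ /=.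
rewrite -(@card_mdeg_lt n (m j) M.+1) ?ltnS // /divisible_count.
rewrite -(@card_mdeg_dvd n p (m j) M.+1) ?ltnS //.
rewrite -[RHS](cardID [pred b : 'X_{1..n < M.+1} | A j b]); congr addn; apply: eq_card => b.
  by rewrite !inE /A ltnS; case: leqP.
rewrite !inE /A ltnS; case: (ltngtP (mdeg b) (m j)) => //= _.
rewrite andbT negb_exists; apply: eq_forallb => k.
by rewrite negbK (characteristic_dvd _ Kp).
Qed.

End FatDegrees.

Theorem corollary3p9 (K : fieldType) (n : nat) (I : idealr {mpoly K[n.+1]})
    (hK : perfect_field K) (hn : (1 <= n)%N)
    (hX : scheme0_ideal I) (hX0 : avoids_X0 I) :
  [/\ forall i : nat,
        (HF_Omega I i%:Z)%:Z =
          (n.+1)%:Z * (HF_scheme I (i%:Z - 1))%:Z + (HF_scheme I i%:Z)%:Z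
          - (HF_scheme (diff_ideal I) i%:Z)%:Z,
      HP (HF_Omega I) = (n.+2%:R * deg_scheme I - deg_scheme (diff_ideal I))%:P,
      ri (HF_Omega I)
        <= Num.max (ri (HF_scheme I) + 1) (ri (HF_scheme (diff_ideal I)))
    & forall (s : nat) (x : 'I_s -> 'I_n.+1 -> K) (m : 'I_s -> nat) (p : nat),
        distinct_points x -> (forall j, (1 <= m j)%N) ->
        (forall f, f \in I <-> fat_point_ideal x m f) ->
        characteristic K p ->
        HP (HF_Omega I) =
          (\sum_(j < s) (n.+2%:R * 'C(m j + n - 1, n)%:R - 'C(m j + n, n)%:R)
           + \sum_(j < s | (p %| m j)%N)
               #|[pred a : 'X_{1..n < (m j %/ p).+1} | mdeg a == (m j %/ p)%N]|%:R
          )%:P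
        /\ ((forall j, m j = 1%N) <-> HP (HF_Omega I) = s%:R%:P)].
Proof.
case: hX => hI _ [supp _].
split=> [i|||s x m p xP m1 IP Kp]; first exact: HF_OmegaE.
- exact: HP_Omega.
- exact: ri_Omega.
have HPE : HP (HF_Omega I) =
    (\sum_(j < s) (n.+2%:R * 'C(m j + n - 1, n)%:R - 'C(m j + n, n)%:R)
     + \sum_(j < s | (p %| m j)%N)
         #|[pred a : 'X_{1..n < (m j %/ p).+1} | mdeg a == (m j %/ p)%N]|%:R)%:P.
  rewrite HP_Omega //; congr (_%:P).
  have := deg_diff_fat hX0 hI xP m1 IP Kp; rewrite (deg_fat hX0 hI xP m1 IP).
  move/(canRL (addrK _)) => ->; rewrite opprB addrA addrAC; congr (_ + _).
  - by rewrite !natr_sum mulr_sumr -sumrB.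
  - by rewrite natr_sum [RHS]big_mkcond; apply: eq_bigr => j _; rewrite /divisible_count; case: ifP.
pose t j : rat := n.+2%:R * 'C(m j + n - 1, n)%:R - 'C(m j + n, n)%:R.
have t_ge j : (if m j == 1%N then 1 else 2) <= t j.
  have := bin_term_ge hn (m1 j); rewrite -(ler_nat rat) natrD natrM.
  by rewrite /t; case: ifP => _; lra.
split=> //; split=> [mE|].
  rewrite HPE; congr (_%:P); rewrite [X in _ + X]big1 ?addr0 => [|j].
    rewrite (eq_bigr (fun=> 1)) => [|j _]; first by rewrite sumr_const card_ord.
    by rewrite mE !add1n subn1 /= binn binSn -[n.+2]addn1 natrD; lra.
  rewrite mE dvdn1 => /eqP p1; case: Kp => [|[]]; last by rewrite p1.
  by rewrite p1 inE.
rewrite HPE => /polyC_inj E j; apply/eqP; case: eqVneq => // mj.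
have ge0 k : true -> 0 <= t k - 1 by have := t_ge k; case: ifP => _; lra.
have sum0 : \sum_k (t k - 1) = 0.
  apply: le_anti; rewrite sumr_ge0 // andbT sumrB sumr_const card_ord -E opprD addNKr.
  by rewrite oppr_le0 sumr_ge0 // => k _; apply: ler0n.
have := psumr_eq0P ge0 sum0 (isT : true) (i := j).
by have := t_ge j; rewrite (negbTE mj); lra.
Qed.
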